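(* Let $\delta:\mathcal{B}\to B$ be any derivation. Then there exist a unique $c_0\in\mathbb{C}$ and a unique $\varphi$-invariant derivation $\partial:\mathcal{F}\to C(G)$ such that $$\delta(b)=c_0[\mathbb{L},b]+\delta_\partial(b)+\tilde\delta(b),\qquad b\in\mathcal{B},$$ where $\tilde\delta:\mathcal{B}\to B$ is an approximately inner derivation (also uniquely determined), and $\delta_\partial:\mathcal{B}\to B$ is the unique derivation with $\delta_\partial(V)=0$ and $\delta_\partial(M_f)=M_{\partial f}$ for $f\in\mathcal{F}$.
   Context: Setup: $G$ is an infinite compact (Hausdorff) abelian group, written additively, and $x_1\in G$ generates a dense cyclic subgroup; $x_n=nx_1$, $\varphi(x)=x+x_1$. $\widehat G$ is the group of continuous characters of $G$ and $\mathcal{F}$ is the linear span of $\widehat G$ in $C(G)$ (note $f\circ\varphi\in\mathcal F$ for $f\in\mathcal F$). Let $H=\ell^2(\mathbb{Z})$ with canonical basis $\{E_l\}$; $VE_l=E_{l+1}$, $M_fE_l=f(x_l)E_l$ for $f\in C(G)$, $\mathbb{L}E_l=lE_l$. $B=C^*(V,M_f:f\in C(G))$ and $\mathcal{B}$ is the $*$-subalgebra generated by $V,V^{-1},M_\chi$ ($\chi\in\widehat G$). A derivation is a linear map satisfying the Leibniz rule; a $\varphi$-invariant derivation $\partial:\mathcal F\to C(G)$ is a derivation with $(\partial f)\circ\varphi=\partial(f\circ\varphi)$ for all $f\in\mathcal F$. A derivation $\tilde\delta:\mathcal{B}\to B$ is approximately inner if there are $y_j\in B$ with $\tilde\delta(b)=\lim_j[y_j,b]$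 in norm for all $b\in\mathcal{B}$. *)

(* Defs.v *)
From mathcomp Require Import all_boot all_algebra.
From mathcomp Require Import all_classical all_reals all_analysis.
From mathcomp Require Import complex.
Set Implicit Arguments. Unset Strict Implicit. Unset Printing Implicit Defensive.
Import GRing.Theory Num.Theory.
Local Open Scope classical_set_scope.
Local Open Scope ring_scope.

Section Defs.
Variable R : realType.
Variable G : topologicalZmodType.

Definition ccontinuous (f : G -> R[i]) : Prop :=
  forall (x : G) (e : R), 0 < e -> \forall y \near x, `|f y - f x| < (e%:C)%C.

Definition is_character (chi : G -> R[i]) : Prop :=
  [/\ ccontinuous chi, (forall x y, chi (x + y) = chi x * chi y)
    & (forall x, `|chi x| = 1)].

Definition in_F (f : G -> R[i]) : Prop :=
  exists s : seq (R[i] * (G -> R[i])),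
    (forall p, p \in s -> is_character p.2) /\
    f = (fun x => \sum_(p <- s) p.1 * p.2 x).

(* vectors of H = l^2(Z) are represented by their coordinates int -> C;
   operators act on all coordinate sequences, only their action on l^2 matters *)
Definition op := (int -> R[i]) -> (int -> R[i]).

Definition n2 (x : int -> R[i]) : \bar R :=
  (\esum_(l in [set: int]) ((complex.Re (x l)) ^+ 2 + (complex.Im (x l)) ^+ 2)%:E)%E.

Definition l2 (x : int -> R[i]) : Prop := (n2 x < +oo)%E.

Definition opnorm_le (T : op) (e : R) : Prop :=
  forall x, l2 x -> (n2 (T x) <= (e ^+ 2)%:E * n2 x)%E.

Definition bounded_op (T : op) : Prop :=
  (forall (x y : int -> R[i]) (c : R[i]), l2 x -> l2 y ->
     T (fun l => c * x l + y l) = (fun l => c * T x l + T y l)) /\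
  exists M : R, opnorm_le T M.

Definition opeq (S T : op) : Prop := forall x, l2 x -> S x = T x.

Definition opadd (S T : op) : op := fun x l => S x l + T x l.
Definition opsub (S T : op) : op := fun x l => S x l - T x l.
Definition opscale (c : R[i]) (T : op) : op := fun x l => c * T x l.
Definition opcomp (S T : op) : op := fun x => S (T x).
Definition opzero : op := fun _ _ => 0.
Definition comm (S T : op) : op := opsub (opcomp S T) (opcomp T S).

(* V E_l = E_{l+1}, V^{-1}, M_f E_l = f(x_l) E_l with x_l = l x1, L E_l = l E_l *)
Definition Vop : op := fun x l => x (l - 1).
Definition Vinv : op := fun x l => x (l + 1).
Definition Mop (x1 : G) (f : G -> R[i]) : op := fun x l => f (x1 *~ l) * x l.
Definition Lop : op := fun x l => l%:~R * x l.

(* calB: the *-subalgebra generated by V, V^{-1}, M_chi (chi a character);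
   it is already *-closed since V^* = V^{-1} and M_chi^* = M_{chi^{-1}}. *)
Inductive calB (x1 : G) : op -> Prop :=
| calB_V : calB x1 Vop
| calB_Vinv : calB x1 Vinv
| calB_M chi : is_character chi -> calB x1 (Mop x1 chi)
| calB_add S T : calB x1 S -> calB x1 T -> calB x1 (opadd S T)
| calB_scale c S : calB x1 S -> calB x1 (opscale c S)
| calB_comp S T : calB x1 S -> calB x1 T -> calB x1 (opcomp S T).

(* B = C^*(V, M_f : f in C(G)): the smallest norm-closed (as operators on H)
   algebra containing V, V^{-1} (= V^* ) and the M_f, f in C(G) (closed under * ). *)
Definition Bset (x1 : G) (T : op) : Prop :=
  bounded_op T /\
  forall S : op -> Prop,
    S Vop -> S Vinv ->
    (forall f, ccontinuous f -> S (Mop x1 f)) ->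
    (forall U W, S U -> S W -> S (opadd U W)) ->
    (forall c U, S U -> S (opscale c U)) ->
    (forall U W, S U -> S W -> S (opcomp U W)) ->
    (forall U W, opeq U W -> S U -> S W) ->
    (forall (u : nat -> op) (U : op), (forall n, S (u n)) -> bounded_op U ->
       (forall e : R, 0 < e -> \forall n \near \oo, opnorm_le (opsub (u n) U) e) ->
       S U) ->
    S T.

Definition is_derivation (x1 : G) (delta : op -> op) : Prop :=
  [/\ (forall b, calB x1 b -> Bset x1 (delta b)),
      (forall a b c, calB x1 a -> calB x1 b ->
         opeq (delta (opadd (opscale c a) b)) (opadd (opscale c (delta a)) (delta b)))
    & (forall a b, calB x1 a -> calB x1 b ->
         opeq (delta (opcomp a b)) (opadd (opcomp (delta a) b) (opcomp a (delta b))))].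

Definition phi_inv_derivation (x1 : G) (d : (G -> R[i]) -> (G -> R[i])) : Prop :=
  [/\ (forall f, in_F f -> ccontinuous (d f)),
      (forall f g c, in_F f -> in_F g ->
         d (fun x => c * f x + g x) = (fun x => c * d f x + d g x)),
      (forall f g, in_F f -> in_F g ->
         d (fun x => f x * g x) = (fun x => d f x * g x + f x * d g x))
    & (forall f, in_F f -> d (fun x => f (x + x1)) = (fun x => d f (x + x1)))].

Definition approx_inner (x1 : G) (delta : op -> op) : Prop :=
  is_derivation x1 delta /\
  exists (J : Type) (F : set_system J), ProperFilter F /\
  exists y : J -> op, (forall j, Bset x1 (y j)) /\
    forall b, calB x1 b -> forall e : R, 0 < e ->
      \forall j \near F, opnorm_le (opsub (comm (y j) b) (delta b)) e.

Definition is_delta_partial (x1 : G) (d : (G -> R[i]) -> (G -> R[i]))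
  (D : op -> op) : Prop :=
  [/\ is_derivation x1 D, opeq (D Vop) opzero
    & (forall f, in_F f -> opeq (D (Mop x1 f)) (Mop x1 (d f)))].

Definition decomposes (x1 : G) (delta : op -> op) (c0 : R[i]) (D Dt : op -> op) : Prop :=
  forall b, calB x1 b ->
    opeq (delta b) (opadd (opscale c0 (comm Lop b)) (opadd (D b) (Dt b))).

End Defs.

(* Main.v *)
Require Import Defs.
From mathcomp Require Import all_boot all_order all_algebra.
From mathcomp Require Import all_classical all_reals all_analysis.
From mathcomp Require Import complex ring lra zify cyclic separable cyclotomic.
Set Implicit Arguments. Unset Strict Implicit. Unset Printing Implicit Defensive.
Import Order.TTheory GRing.Theory Num.Theory.
Local Open Scope classical_set_scope.
Local Open Scope ring_scope.

(* The matrix of T in B has diagonals l |-> <T E_l, E_(l+n)> = f_n(x_l) with f_n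
   continuous, and T is the norm limit of its Fejer sums.  Comparing diagonals
   in delta(M_chi M_psi) = delta(M_psi M_chi) and in the relation between V and
   M_psi, the n-th diagonal part of delta is, for n <> 0, the commutator with
   V^n M_b for b = (n-th diagonal of delta(M_psi)) / (psi (1 - psi(x_n))), where
   psi is a character with psi(x_n) <> 1.  The diagonal part is the derivation
   of partial on the M_f, and on V it is V M_f for a continuous f; the mean of f
   is c_0 and f - c_0 is a uniform limit of coboundaries u(x + x_1) - u(x), i.e.
   V M_(f - c_0) is a limit of commutators [M_u, V].  So Fejer sums of the V^n M_b
   together with the M_u implement the remainder approximately.  Conversely,
   commutators with elements of B have zero diagonal on M_f and a coboundary as
   diagonal on V, so c_0 and partial can be read off from delta.

   Characters separating x_n from 0 are built from averages along the orbit,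
   (1/N) sum_(l < N) z^l f(x + x_l): limits of these for |z| = 1 are eigenfunctions
   of translation by x_1, and finite Fourier analysis on Z/M shows that, by almost
   periodicity of l |-> f(x_l), some of these limits do not vanish. *)

(** The elements V^n M_b for different n need not have a convergent sum, and no bound on b in terms
    of n is available, so the remainder is only approximated by inner derivations. Fejer weights
    remove the difficulty: the commutator of the weighted sum with M_chi is exactly the Fejer sum of
    the remainder at M_chi, and that converges because its argument already lies in B. The only
    estimate required is that Fejer summation does not increase operator bounds. The mean is treated
    without integration: c_0 is characterised by f - c_0 being a uniform limit of coboundaries.
    Limits of averages are taken along an ultrafilter on the natural numbers, so they exist at all
    points of G at once. Operators act on all coordinate sequences but are compared on l^2 only.
    Identities between elements of calB hold on all sequences, hence can be rewritten under delta;
    values of delta are known only up to [opeq]. *)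

(** * Real-valued modulus of complex numbers *)

Section ComplexModulus.
Variable R : realType.
Implicit Types z w : R[i].

(** The norm [|z|] takes values in [R[i]]; a real-valued version allows real bounds, suprema and
    linear arithmetic. *)
Definition cabs z : R := Num.sqrt (complex.Re z ^+ 2 + complex.Im z ^+ 2).

Lemma normE z : `|z| = (cabs z)%:C%C. Proof. exact: normc_def. Qed.

Lemma cabs_ge0 z : 0 <= cabs z. Proof. exact: sqrtr_ge0. Qed.

Lemma sqr_cabs z : cabs z ^+ 2 = complex.Re z ^+ 2 + complex.Im z ^+ 2.
Proof. by rewrite sqr_sqrtr // addr_ge0 // sqr_ge0. Qed.

Lemma cabsM z w : cabs (z * w) = cabs z * cabs w.
Proof. by apply: complexI; rewrite rmorphM /= -!normE normrM. Qed.

Lemma cabsD z w : cabs (z + w) <= cabs z + cabs w.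
Proof. by rewrite -lecR rmorphD /= -!normE ler_normD. Qed.

Lemma cabsN z : cabs (- z) = cabs z.
Proof. by apply: complexI; rewrite -!normE normrN. Qed.

Lemma cabs0 : cabs (0 : R[i]) = 0.
Proof. by apply: complexI; rewrite -!normE normr0. Qed.

Lemma cabs1 : cabs (1 : R[i]) = 1.
Proof. by apply: complexI; rewrite -!normE normr1. Qed.

Lemma cabs_eq0 z : (cabs z == 0) = (z == 0).
Proof. by rewrite -(inj_eq (@complexI R)) -normE normr_eq0. Qed.

Lemma cabs_gt0 z : (0 < cabs z) = (z != 0).
Proof. by rewrite lt0r cabs_eq0 cabs_ge0 andbT. Qed.

Lemma cabsV z : cabs z^-1 = (cabs z)^-1.
Proof. by apply: complexI; rewrite fmorphV /= -!normE normfV. Qed.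

Lemma cabsX z n : cabs (z ^+ n) = cabs z ^+ n.
Proof. by apply: complexI; rewrite rmorphXn /= -!normE normrX. Qed.

Lemma cabs_real (x : R) : cabs x%:C%C = `|x|.
Proof. by rewrite /cabs /= expr0n addr0 sqrtr_sqr. Qed.

Lemma cabs_nat n : cabs (n%:R : R[i]) = n%:R.
Proof. by rewrite -(rmorph_nat (real_complex R)) cabs_real ger0_norm. Qed.

Lemma cabsJ z : cabs (z^*)%C = cabs z.
Proof. by apply: complexI; rewrite -!normE normcJ. Qed.

Lemma mulcJ z : z * (z^*)%C = (cabs z ^+ 2)%:C%C.
Proof. by rewrite -sqr_normc normE rmorphXn. Qed.

Lemma cabs_sum (I : Type) (r : seq I) (P : pred I) (F : I -> R[i]) :
  cabs (\sum_(i <- r | P i) F i) <= \sum_(i <- r | P i) cabs (F i).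
Proof.
elim/big_ind2: _ => // [|x1 y1 x2 y2 h1 h2]; first by rewrite cabs0.
exact: le_trans (cabsD _ _) (lerD _ _).
Qed.

Lemma cabs_distC z w : cabs (z - w) = cabs (w - z).
Proof. by rewrite -cabsN opprB. Qed.

Lemma cabs_dist_add z w t : cabs (z - w) <= cabs (z - t) + cabs (t - w).
Proof. by apply: le_trans (cabsD _ _); rewrite addrA subrK. Qed.

Lemma Re_le_cabs z : complex.Re z <= cabs z.
Proof.
apply: le_trans (ler_norm _) _.
by rewrite -sqrtr_sqr ler_sqrt ?addr_ge0 ?sqr_ge0 // lerDl sqr_ge0.
Qed.

Lemma cabs_le_ReIm z : cabs z <= `|complex.Re z| + `|complex.Im z|.
Proof.
rewrite -(@ler_pXn2r _ 2) ?nnegrE ?cabs_ge0 ?addr_ge0 //.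
rewrite sqr_cabs sqrrD -(real_normK (num_real (complex.Re z))).
rewrite -(real_normK (num_real (complex.Im z))) lerD2r lerDl.
by rewrite mulrn_wge0 // mulr_ge0.
Qed.

Lemma Re_norm_le z : `|complex.Re z| <= cabs z.
Proof.
by rewrite -sqrtr_sqr ler_sqrt ?addr_ge0 ?sqr_ge0 // lerDl sqr_ge0.
Qed.

Lemma Im_norm_le z : `|complex.Im z| <= cabs z.
Proof.
by rewrite -sqrtr_sqr ler_sqrt ?addr_ge0 ?sqr_ge0 // lerDr sqr_ge0.
Qed.

(* [|z + w|^2 <= (1 + t) |z|^2 + (1 + 1/t) |w|^2] with [t = b / a]: summed over
   coordinates it gives the triangle inequality for operator bounds [a], [b]. *)
Lemma sqr_cabsD (a b : R) z w : 0 < a -> 0 < b ->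
  cabs (z + w) ^+ 2 <= (a + b) / a * cabs z ^+ 2 + (a + b) / b * cabs w ^+ 2.
Proof.
move=> a0 b0.
apply: (@le_trans _ _ ((cabs z + cabs w) ^+ 2)).
  by rewrite ler_pXn2r ?nnegrE ?cabs_ge0 ?addr_ge0 ?cabs_ge0 ?cabsD.
rewrite -subr_ge0; set p := cabs z; set q := cabs w.
have -> : (a + b) / a * p ^+ 2 + (a + b) / b * q ^+ 2 - (p + q) ^+ 2
   = (b * p - a * q) ^+ 2 / (a * b) by field; rewrite !gt_eqF.
by rewrite divr_ge0 ?sqr_ge0 // mulr_ge0 // ltW.
Qed.

(** The squares of |F i| - [m] have a nonnegative sum, with [m] the modulus of the sum divided by n;
    expanding and using the triangle inequality gives this case of Jensen's inequality. *)
Lemma sqr_mean_cabs (n : nat) (F : 'I_n -> R[i]) : (0 < n)%N ->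
  cabs (n%:R^-1 * \sum_i F i) ^+ 2 <= n%:R^-1 * \sum_i cabs (F i) ^+ 2.
Proof.
move=> n0; have nR : 0 < n%:R :> R by rewrite ltr0n.
rewrite cabsM cabsV cabs_nat exprMn [n%:R^-1 ^+ 2]expr2 -mulrA.
rewrite ler_pM2l ?invr_gt0 // ler_pdivrMl //.
set s := cabs _; have s0 : 0 <= s by exact: cabs_ge0.
have hs : s <= \sum_i cabs (F i) by exact: cabs_sum.
pose m := s / n%:R.
have : 0 <= \sum_i (cabs (F i) - m) ^+ 2 by apply: sumr_ge0 => i _; exact: sqr_ge0.
rewrite (eq_bigr (fun i => cabs (F i) ^+ 2 + (- m *+ 2 * cabs (F i) + m ^+ 2)));
  last by move=> i _; ring.
rewrite !big_split /= -mulr_sumr sumr_const card_ord.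
set Q := \sum_i _ ^+ 2; set S := \sum_i _ in hs *.
move=> h.
have {}h : m *+ 2 * S - m ^+ 2 *+ n <= Q by move: h; rewrite mulNrn mulNr; lra.
have m0 : 0 <= m by rewrite divr_ge0 // ltW.
have h2 : m * 2 * s - m ^+ 2 *+ n <= Q.
  apply: le_trans h; rewrite lerD2r mulr_natr; apply: ler_wpM2l => //.
  by rewrite mulrn_wge0.
have e : m * 2 * s - m ^+ 2 *+ n = s ^+ 2 / n%:R.
  by rewrite /m -mulr_natr; field; rewrite gt_eqF.
by rewrite e ler_pdivrMr // mulrC in h2.
Qed.

End ComplexModulus.

(** * The squared l^2 norm as an extended sum *)

Section EuclideanNorm.
Variable R : realType.
Implicit Types x y : int -> R[i].
Local Open Scope ereal_scope.

Lemma n2E x : n2 x = \esum_(l in [set: int]) (cabs (x l) ^+ 2)%:E.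
Proof. by apply: eq_esum => l _; rewrite sqr_cabs. Qed.

Lemma n2_ge0 x : 0 <= n2 x.
Proof. by rewrite n2E; apply: esum_ge0 => l _; rewrite lee_fin sqr_ge0. Qed.

Lemma esum_shift (a : int -> \bar R) (k : int) :
  \esum_(l in [set: int]) a (l + k)%R = \esum_(l in [set: int]) a l.
Proof.
symmetry; apply: reindex_esum; split => //.
  by move=> p q _ _ /addIr.
by move=> p _; exists (p - k)%R => //; rewrite subrK.
Qed.

Lemma esumZ (c : R) (a : int -> R) : (0 <= c)%R -> (forall l, 0 <= a l)%R ->
  \esum_(l in [set: int]) (c * a l)%:E <= c%:E * \esum_(l in [set: int]) (a l)%:E.
Proof.
move=> c0 a0; apply: ge_ereal_sup => _ [X [finX _]] <-.
rewrite (eq_fsbigr (fun l => c%:E * (a l)%:E)); last by move=> l _; rewrite EFinM.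
rewrite -ge0_mule_fsumr; last by move=> l; rewrite lee_fin.
by apply: lee_wpmul2l; [rewrite lee_fin | apply: esum_ge; exists X].
Qed.

Lemma n2_shift x (k : int) : n2 (fun l => x (l + k)%R) = n2 x.
Proof. by rewrite !n2E (esum_shift (fun l => (cabs (x l) ^+ 2)%:E)). Qed.

Lemma le_n2_scaled (C : R) x y : (forall l, cabs (y l) <= C * cabs (x l))%R ->
  n2 y <= (C ^+ 2)%:E * n2 x.
Proof.
move=> h; rewrite !n2E; apply: le_trans; last first.
  by apply: esumZ => [|l]; rewrite sqr_ge0.
apply: le_esum => l _; rewrite lee_fin -exprMn.
rewrite ler_pXn2r ?nnegrE ?cabs_ge0 //.
by apply: le_trans (h l); exact: cabs_ge0.
Qed.

Lemma n2D (a b : R) x y : (0 < a)%R -> (0 < b)%R ->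
  n2 (fun l => x l + y l)%R <=
  ((a + b) / a)%:E * n2 x + ((a + b) / b)%:E * n2 y.
Proof.
move=> a0 b0; have ab : (0 <= a + b)%R by rewrite addr_ge0 ?ltW.
rewrite !n2E; apply: (@le_trans _ _ (\esum_(l in [set: int])
    (((a + b) / a * cabs (x l) ^+ 2)%:E + ((a + b) / b * cabs (y l) ^+ 2)%:E))).
  by apply: le_esum => l _; rewrite -EFinD lee_fin; exact: sqr_cabsD.
rewrite esumD; first by apply: leeD; apply: esumZ => [|l];
  rewrite ?sqr_ge0 ?divr_ge0 // ltW.
all: by move=> l _; rewrite lee_fin mulr_ge0 ?sqr_ge0 ?divr_ge0 // ltW.
Qed.

Lemma le_n2_coord x (l : int) : (cabs (x l) ^+ 2)%:E <= n2 x.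
Proof.
rewrite n2E; apply: esum_ge; exists [set l]; last by rewrite fsbig_set1.
by split.
Qed.

Lemma l2_lin (c : R[i]) x y : l2 x -> l2 y -> l2 (fun l => c * x l + y l)%R.
Proof.
move=> hx hy; rewrite /l2.
apply: le_lt_trans (@n2D 1%R 1%R (fun l => c * x l)%R y _ _) _ => //.
apply: lte_add_pinfty; apply: lte_mul_pinfty => //; try exact: n2_ge0;
  rewrite ?lee_fin ?divr_ge0 ?addr_ge0 //.
apply: le_lt_trans (@le_n2_scaled (cabs c) x _ _) _.
  by move=> l; rewrite cabsM.
by apply: lte_mul_pinfty => //; rewrite ?lee_fin ?sqr_ge0 ?n2_ge0.
Qed.

Lemma l2_0 : l2 (fun=> 0%R : R[i]).
Proof.
rewrite /l2 n2E esum1 ?ltry // => l _.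
by rewrite cabs0 expr0n.
Qed.

Lemma l2Z (c : R[i]) x : l2 x -> l2 (fun l => c * x l)%R.
Proof.
move=> hx; have := l2_lin c hx l2_0; congr (l2 _).
by apply/funext => l; rewrite addr0.
Qed.

Lemma l2D x y : l2 x -> l2 y -> l2 (fun l => x l + y l)%R.
Proof.
move=> hx hy; have := l2_lin 1%R hx hy; congr (l2 _).
by apply/funext => l; rewrite mul1r.
Qed.

Lemma l2_sum (I : Type) (r : seq I) (F : I -> int -> R[i]) :
  (forall i, l2 (F i)) -> l2 (fun l => \sum_(i <- r) F i l)%R.
Proof.
move=> hF; elim: r => [|i r IH].
  have := l2_0; congr (l2 _).
  by apply/funext => l; rewrite big_nil.
have := l2D (hF i) IH; congr (l2 _).
by apply/funext => l; rewrite big_cons.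
Qed.

Definition ebasis (k : int) : int -> R[i] := fun l => if l == k then 1%R else 0%R.

Lemma n2_basis k : n2 (ebasis k) = 1.
Proof.
rewrite n2E (esumID [set k]) //; last by move=> *; rewrite lee_fin sqr_ge0.
rewrite setTI esum_set1 ?lee_fin ?sqr_ge0 // /ebasis eqxx cabs1 expr1n esum1 ?adde0 //.
by move=> l [_ /eqP/negPf]; rewrite /= => ->; rewrite cabs0 expr0n.
Qed.

Lemma l2_basis k : l2 (ebasis k).
Proof. by rewrite /l2 n2_basis ltry. Qed.

End EuclideanNorm.

(** * Operator bounds, weighted shifts and Fejer sums *)

Section BoundedOperators.
Variable R : realType.
Implicit Types (x y : int -> R[i]) (S T : op R).

Lemma opnorm_leW T (a b : R) : 0 <= a -> a <= b -> opnorm_le T a -> opnorm_le T b.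
Proof.
move=> a0 ab hT x hx; apply: le_trans (hT x hx) _.
apply: lee_wpmul2r; first exact: n2_ge0.
by rewrite lee_fin ler_pXn2r ?nnegrE // (le_trans a0).
Qed.

(** The bound enters [opnorm_le] only through its square, so it may be negative or zero; |a| + 1 is
    a bound that can be divided by. *)
Lemma opnorm_le_pos T (a : R) : opnorm_le T a -> exists2 b, 0 < b & opnorm_le T b.
Proof.
move=> hT; exists (`|a| + 1); first by rewrite ltr_wpDl.
apply: (@opnorm_leW _ `|a|) => //; first by rewrite lerDl.
by move=> x hx; rewrite real_normK ?num_real //; exact: hT.
Qed.

Lemma opnorm_le_l2 T a x : opnorm_le T a -> l2 x -> l2 (T x).
Proof.
move=> hT hx; apply: le_lt_trans (hT x hx) _.
by apply: lte_mul_pinfty => //; rewrite ?lee_fin ?sqr_ge0 ?n2_ge0.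
Qed.

Lemma opnorm_leD S T (a b : R) : 0 < a -> 0 < b ->
  opnorm_le S a -> opnorm_le T b -> opnorm_le (opadd S T) (a + b).
Proof.
move=> a0 b0 hS hT x hx; apply: le_trans (n2D _ _ a0 b0) _.
have ab : 0 < a + b by rewrite addr_gt0.
apply: (@le_trans _ _ (((a + b) / a)%:E * ((a ^+ 2)%:E * n2 x) +
                       ((a + b) / b)%:E * ((b ^+ 2)%:E * n2 x))%E).
  apply: leeD; (apply: lee_wpmul2l; first by rewrite lee_fin divr_ge0 ?ltW).
    exact: hS.
  exact: hT.
have p1 : 0 <= (a + b) / a * a ^+ 2 by rewrite mulr_ge0 ?divr_ge0 ?sqr_ge0 ?ltW.
have p2 : 0 <= (a + b) / b * b ^+ 2 by rewrite mulr_ge0 ?divr_ge0 ?sqr_ge0 ?ltW.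
rewrite !muleA -!EFinM -ge0_muleDl ?lee_fin // -EFinD.
suff -> : (a + b) / a * a ^+ 2 + (a + b) / b * b ^+ 2 = (a + b) ^+ 2 by [].
by field; rewrite !gt_eqF.
Qed.

Lemma opnorm_leZ T (c : R[i]) (a : R) :
  opnorm_le T a -> opnorm_le (opscale c T) (cabs c * a).
Proof.
move=> hT x hx; rewrite exprMn EFinM -muleA.
apply: (@le_trans _ _ ((cabs c ^+ 2)%:E * n2 (T x))%E).
  by apply: le_n2_scaled => l; rewrite cabsM.
by apply: lee_wpmul2l; [rewrite lee_fin sqr_ge0 | exact: hT].
Qed.

Lemma opeq_opnorm S T (a : R) : opeq S T -> opnorm_le S a -> opnorm_le T a.
Proof. by move=> h hS x hx; rewrite -h //; exact: hS. Qed.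

Lemma opnorm_le_subC S T (a : R) :
  opnorm_le (opsub S T) a -> opnorm_le (opsub T S) a.
Proof.
move=> h; have := opnorm_leZ (-1) h; rewrite cabsN cabs1 mul1r.
apply: opeq_opnorm => x _; apply/funext => l.
by rewrite /opscale /opsub mulN1r opprB.
Qed.

Lemma opnorm_le_comp S T (a b : R) :
  opnorm_le S a -> opnorm_le T b -> opnorm_le (opcomp S T) (a * b).
Proof.
move=> hS hT x hx; rewrite exprMn EFinM -muleA.
apply: le_trans (hS _ (opnorm_le_l2 hT hx)) _.
by apply: lee_wpmul2l; [rewrite lee_fin sqr_ge0 | exact: hT].
Qed.

Lemma opnorm_entry T (e : R) k l : 0 <= e -> opnorm_le T e ->
  cabs (T (ebasis R k) l) <= e.
Proof.
move=> e0 hT; have := hT _ (l2_basis R k).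
rewrite n2_basis mule1 => /(le_trans (le_n2_coord _ l)).
by rewrite lee_fin ler_pXn2r ?nnegrE ?cabs_ge0.
Qed.

Lemma bounded_lin T x y (c : R[i]) : bounded_op T -> l2 x -> l2 y ->
  T (fun l => c * x l + y l) = (fun l => c * T x l + T y l).
Proof. by move=> [h _]; exact: h. Qed.

Lemma bounded_0 T : bounded_op T -> T (fun=> 0) = (fun=> 0).
Proof.
move=> bT; have := bounded_lin 1 bT (l2_0 R) (l2_0 R).
rewrite (_ : (fun=> _) = (fun=> 0)); last by apply/funext => l; rewrite mul1r addr0.
move=> h; apply/funext => l; have := congr1 (fun f => f l) h.
by rewrite mul1r => /esym/(canRL (addrK _)); rewrite subrr.
Qed.

Lemma bounded_D T x y : bounded_op T -> l2 x -> l2 y ->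
  T (fun l => x l + y l) = (fun l => T x l + T y l).
Proof.
move=> bT hx hy; have := bounded_lin 1 bT hx hy.
congr (T _ = _); by apply/funext => l; rewrite mul1r.
Qed.

Lemma bounded_Z T x (c : R[i]) : bounded_op T -> l2 x ->
  T (fun l => c * x l) = (fun l => c * T x l).
Proof.
move=> bT hx; have := bounded_lin c bT hx (l2_0 R).
rewrite bounded_0 //; congr (T _ = _); by apply/funext => l; rewrite addr0.
Qed.

Lemma bounded_sum T (I : Type) (r : seq I) (F : I -> int -> R[i]) :
  bounded_op T -> (forall i, l2 (F i)) ->
  T (fun l => \sum_(i <- r) F i l) = (fun l => \sum_(i <- r) T (F i) l).
Proof.
move=> bT hF; elim: r => [|i r IH].
  rewrite (_ : (fun=> _) = (fun=> 0)); last by apply/funext => l; rewrite big_nil.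
  by rewrite bounded_0 //; apply/funext => l; rewrite big_nil.
rewrite (_ : (fun=> _) = (fun l => F i l + \sum_(j <- r) F j l)); last first.
  by apply/funext => l; rewrite big_cons.
rewrite bounded_D //; last exact: l2_sum.
by apply/funext => l; rewrite big_cons IH.
Qed.

Lemma bounded_l2 T x : bounded_op T -> l2 x -> l2 (T x).
Proof. by move=> [_ [M hM]]; exact: opnorm_le_l2 hM. Qed.

Lemma bounded_norm T : bounded_op T -> exists2 a, 0 < a & opnorm_le T a.
Proof. by move=> [_ [M hM]]; exact: opnorm_le_pos hM. Qed.

Lemma bounded_eq S T : opeq S T -> bounded_op S -> bounded_op T.
Proof.
move=> e [lS [M hM]]; split; last by exists M; apply: opeq_opnorm hM.
move=> x y c hx hy; rewrite -(e _ (l2_lin c hx hy)) -(e _ hx) -(e _ hy).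
exact: lS.
Qed.

Lemma bounded_add S T : bounded_op S -> bounded_op T -> bounded_op (opadd S T).
Proof.
move=> bS bT; split.
  move=> x y c hx hy; rewrite /opadd !bounded_lin //.
  by apply/funext => l; ring.
have [a a0 hS] := bounded_norm bS; have [b b0 hT] := bounded_norm bT.
by exists (a + b); exact: opnorm_leD.
Qed.

Lemma bounded_scale c T : bounded_op T -> bounded_op (opscale c T).
Proof.
move=> bT; split.
  move=> x y d hx hy; rewrite /opscale !bounded_lin //.
  by apply/funext => l; ring.
have [b b0 hT] := bounded_norm bT.
by exists (cabs c * b); exact: opnorm_leZ.
Qed.

Lemma bounded_sub S T : bounded_op S -> bounded_op T -> bounded_op (opsub S T).
Proof.
move=> bS bT; apply: (@bounded_eq (opadd S (opscale (-1) T))).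
  by move=> x _; apply/funext => l; rewrite /opadd /opscale mulN1r.
by apply: bounded_add => //; exact: bounded_scale.
Qed.

Lemma bounded_comp S T : bounded_op S -> bounded_op T -> bounded_op (opcomp S T).
Proof.
move=> bS bT; split.
  by move=> x y d hx hy; rewrite /opcomp !bounded_lin //; exact: bounded_l2.
have [a a0 hS] := bounded_norm bS; have [b b0 hT] := bounded_norm bT.
by exists (a * b); exact: opnorm_le_comp.
Qed.

(** This is V^k times the diagonal operator with entries [a]. The weights form an arbitrary
    sequence, so they can also be given directly by matrix entries. *)
Definition wshift (k : int) (a : int -> R[i]) : op R :=
  fun x l => a (l - k) * x (l - k).

Lemma opnorm_wshift k a (C : R) : (forall l, cabs (a l) <= C) ->
  opnorm_le (wshift k a) C.
Proof.
move=> h x hx; rewrite -(n2_shift x (- k)).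
by apply: le_n2_scaled => l; rewrite cabsM ler_wpM2r ?cabs_ge0.
Qed.

Lemma bounded_wshift k a (C : R) : (forall l, cabs (a l) <= C) ->
  bounded_op (wshift k a).
Proof.
move=> h; split; last by exists C; exact: opnorm_wshift.
by move=> x y c _ _; apply/funext => l; rewrite /wshift; ring.
Qed.

(** The diagonal n = j - i occurs for N - |n| pairs (j, i), so these are the Fejer sums with weights
    1 - |n|/N for |n| < N. For fixed j the inner sum is the coordinate at l of [T] applied to [x]
    cut down to the N indices from l - j on. *)
Definition fejer (N : nat) T : op R := fun x l =>
  N%:R^-1 * \sum_(j < N) \sum_(i < N)
    T (ebasis R (l - j%:Z + i%:Z)) l * x (l - j%:Z + i%:Z).

Definition window (N : nat) (m : int) x : int -> R[i] :=
  fun l => \sum_(i < N) x (m + i%:Z) * ebasis R (m + i%:Z) l.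

Lemma windowE N m x l :
  window N m x l = if (m <= l < m + N%:Z) then x l else 0.
Proof.
rewrite /window; case: ifP => [/andP[h1 h2]|h].
  have ltN : (`|l - m| < N)%N by lia.
  have e : m + `|l - m|%N%:Z = l by lia.
  rewrite (bigD1 (Ordinal ltN)) //= e /ebasis eqxx mulr1 big1 ?addr0 //.
  move=> i /eqP ne; case: eqP => [e2|]; rewrite ?mulr0 //.
  by case: ne; apply/val_inj => /=; lia.
apply: big1 => i _; rewrite /ebasis; case: eqP => [e|]; rewrite ?mulr0 //.
by have := ltn_ord i; lia.
Qed.

Lemma l2_window N m x : l2 (window N m x).
Proof. by apply: l2_sum => i; apply: l2Z; exact: l2_basis. Qed.

Lemma bounded_window N m x T l : bounded_op T ->
  T (window N m x) l = \sum_(i < N) T (ebasis R (m + i%:Z)) l * x (m + i%:Z).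
Proof.
move=> bT; rewrite /window bounded_sum //; last first.
  by move=> i; apply: l2Z; exact: l2_basis.
apply: eq_bigr => i _; rewrite bounded_Z //; last exact: l2_basis.
by rewrite mulrC.
Qed.

Lemma sum_window_le (a : int -> R) (N : nat) (m : int) : (forall l, 0 <= a l) ->
  (\sum_(j < N) (a (m + j%:Z))%:E <= \esum_(l in [set: int]) (a l)%:E)%E.
Proof.
move=> a0.
have finX : finite_set [set` [seq m + (nat_of_ord i)%:Z | i <- enum 'I_N]] by exact: finite_seq.
apply: esum_ge; exists [set` [seq m + (nat_of_ord i)%:Z | i <- enum 'I_N]]; first by split.
rewrite -fsbig_seq; last first.
  by rewrite map_inj_uniq ?enum_uniq // => i j /addrI [] /val_inj.
by rewrite big_map big_enum.
Qed.

Lemma n2_window N m x :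
  n2 (window N m x) = (\sum_(i < N) (cabs (x (m + i%:Z)) ^+ 2)%:E)%E.
Proof.
rewrite n2E; transitivity (\esum_(l in [set: int]) (\sum_(i < N)
   (cabs (x (m + i%:Z)) ^+ 2 * (l == m + i%:Z)%:R)%:E))%E.
  apply: eq_esum => l _; rewrite windowE; case: ifP => [/andP[h1 h2]|h].
    have ltN : (`|l - m| < N)%N by lia.
    have e : m + `|l - m|%N%:Z = l by lia.
    rewrite (bigD1 (Ordinal ltN)) //= e eqxx mulr1 big1 ?adde0 //.
    move=> i /eqP ne; case: eqP => [e2|]; rewrite ?mulr0 //.
    by case: ne; apply/val_inj => /=; lia.
  rewrite cabs0 expr0n big1 // => i _; case: eqP => [e|]; rewrite ?mulr0 //.
  by have := ltn_ord i; lia.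
rewrite esum_sum; last by move=> *; rewrite lee_fin mulr_ge0 ?sqr_ge0.
apply: eq_bigr => i _.
rewrite (esumID [set m + i%:Z]) //; last first.
  by move=> *; rewrite lee_fin mulr_ge0 ?sqr_ge0.
rewrite setTI (@esum_set1 R); last by rewrite lee_fin mulr_ge0 ?sqr_ge0.
rewrite [X in (_ + X)%E]esum1 ?adde0 ?eqxx ?mulr1 //.
by move=> l [_ /eqP/negPf]; rewrite /= => ->; rewrite mulr0.
Qed.

(* The triangular weights are the average of compressions to windows of
   length [N], so Jensen's inequality and a shift of the summation index
   reduce the bound to the one for [T] on windows. *)
Lemma fejer_contraction N T (a : R) : bounded_op T -> opnorm_le T a ->
  opnorm_le (fejer N T) a.
Proof.
move=> bT hT x hx; case: N => [|N].
  rewrite (_ : fejer 0 T x = fun=> 0); last first.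
    by apply/funext => l; rewrite /fejer big_ord0 mulr0.
  rewrite n2E esum1; last by move=> l _; rewrite cabs0 expr0n.
  by rewrite mule_ge0 ?lee_fin ?sqr_ge0 ?n2_ge0.
set n := N.+1; have n0 : 0 <= n%:R^-1 :> R by rewrite invr_ge0.
pose b m l := cabs (T (window n m x) l) ^+ 2.
have b0 m l : 0 <= b m l by exact: sqr_ge0.
have h1 : (n2 (fejer n T x) <= (n%:R^-1)%:E *
    \esum_(l in [set: int]) (\sum_(j < n) b (l - j%:Z) l)%:E)%E.
  rewrite n2E; apply: le_trans; last first.
    by apply: esumZ => // l; apply: sumr_ge0 => j _.
  apply: le_esum => l _; rewrite lee_fin.
  apply: le_trans; last exact: sqr_mean_cabs.
  rewrite /fejer; under eq_bigr do rewrite -bounded_window //.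
  exact: lexx.
apply: le_trans h1 _.
have -> : (\esum_(l in [set: int]) (\sum_(j < n) b (l - j%:Z) l)%:E =
   \esum_(m in [set: int]) (\sum_(j < n) (b m (m + j%:Z))%:E))%E.
  under eq_esum do rewrite -sumEFin.
  rewrite !esum_sum; try by move=> *; rewrite lee_fin.
  apply: eq_bigr => j _.
  rewrite -(esum_shift (fun l => (b (l - j%:Z) l)%:E) j%:Z).
  by apply: eq_esum => l _; rewrite addrK.
have h2 : (\esum_(m in [set: int]) (\sum_(j < n) (b m (m + j%:Z))%:E) <=
   \esum_(m in [set: int]) (a ^+ 2 * \sum_(i < n) cabs (x (m + i%:Z)) ^+ 2)%:E)%E.
  apply: le_esum => m _.
  apply: le_trans (sum_window_le _ _ _) _; first by move=> l.
  rewrite -n2E; apply: le_trans (hT _ (l2_window _ _ _)) _.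
  by rewrite n2_window sumEFin -EFinM.
apply: le_trans (lee_wpmul2l _ h2) _; first by rewrite lee_fin.
have h3 := @esumZ R (a ^+ 2) (fun m => \sum_(i < n) cabs (x (m + i%:Z)) ^+ 2).
apply: le_trans (lee_wpmul2l _ (h3 _ _)) _; rewrite ?lee_fin ?sqr_ge0 //.
  by move=> l; apply: sumr_ge0 => *; exact: sqr_ge0.
under eq_esum do rewrite -sumEFin.
rewrite esum_sum; last by move=> *; rewrite lee_fin sqr_ge0.
(* Every coordinate of [x] lies in exactly [n] windows of length [n], which cancels the factor
   1/n. *)
rewrite (eq_bigr (fun=> n2 x)); last first.
  by move=> j _; rewrite (esum_shift (fun l => (cabs (x l) ^+ 2)%:E)) -n2E.
have -> : (\sum_(j < n) n2 x = n%:R%:E * n2 x)%E.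
  by rewrite sumr_const card_ord mule_natl.
rewrite muleCA (muleA _ _ (n2 x)) -EFinM mulVf ?mul1e //.
by rewrite pnatr_eq0.
Qed.

Lemma fejer_sub N S T : fejer N (opsub S T) = opsub (fejer N S) (fejer N T).
Proof.
apply/funext => x; apply/funext => l; rewrite /fejer /opsub -mulrBr -sumrB.
congr (_ * _); apply: eq_bigr => j _; rewrite -sumrB.
by apply: eq_bigr => i _; rewrite mulrBl.
Qed.

Lemma fejer_add N S T : fejer N (opadd S T) = opadd (fejer N S) (fejer N T).
Proof.
apply/funext => x; apply/funext => l; rewrite /fejer /opadd -mulrDr -big_split /=.
congr (_ * _); apply: eq_bigr => j _; rewrite -big_split /=.
by apply: eq_bigr => i _; rewrite mulrDl.
Qed.

Definition opcvg (u : nat -> op R) T :=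
  forall e : R, 0 < e -> \forall n \near \oo, opnorm_le (opsub (u n) T) e.

Lemma sum_ltn_const (N m : nat) : (\sum_(j < N) (j < m)%N <= m)%N.
Proof.
have -> : (\sum_(j < N) (j < m)%N = minn N m)%N; last exact: geq_minr.
by elim: N => [|N IH]; rewrite ?big_ord0 ?big_ord_recr /= ?IH; lia.
Qed.

(** Each j has at most one partner i = j - k, and none for at most |k| values of j: those at the low
    end if k >= 0, at the high end otherwise. Reversing the indices turns the second case into the
    first. Divided by N, the count tends to 1. *)
Lemma count_diff (N : nat) (k : int) :
  let c := (\sum_(j < N) \sum_(i < N) (j%:Z - i%:Z == k)%R)%N in
  (c <= N <= c + `|k|)%N.
Proof.
rewrite /=; set c := (\sum_(j < N) _)%N.
have hc : c = (\sum_(j < N) ((0 <= j%:Z - k) && (j%:Z - k < N%:Z))%R)%N.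
  apply: eq_bigr => j _.
  case: (boolP (_ && _)) => [/andP[h1 h2]|h] /=.
    have ltN : (`|j%:Z - k| < N)%N by lia.
    rewrite (bigD1 (Ordinal ltN)) //= big1 ?addn0.
      by case: eqP => //; lia.
    move=> i /eqP ne; case: eqP => //= e.
    by case: ne; apply/val_inj => /=; lia.
  apply: big1 => i _; case: eqP => // e; have := ltn_ord i.
  by move: h; rewrite negb_and; lia.
have le : (c <= N)%N.
  rewrite hc -[X in (_ <= X)%N](card_ord N) -sum1_card; apply: leq_sum => j _.
  by case: (_ && _).
rewrite le /= hc.
rewrite -[X in (X <= _)%N](card_ord N) -sum1_card.
rewrite (eq_bigr (fun j : 'I_N => (((0 <= j%:Z - k) && (j%:Z - k < N%:Z))%R +
     ~~ ((0 <= j%:Z - k) && (j%:Z - k < N%:Z))%R)%N)); last first.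
  by move=> j _; case: (_ && _).
rewrite big_split /= leq_add2l.
have [k0|k0] := leP 0 k.
  rewrite (eq_bigr (fun j : 'I_N => nat_of_bool (j < `|k|)%N)).
    exact: sum_ltn_const.
  by move=> j _; have hj := ltn_ord j; congr nat_of_bool; lia.
rewrite (reindex_inj rev_ord_inj) /=.
rewrite (eq_bigr (fun j : 'I_N => nat_of_bool (j < `|k|)%N)).
  exact: sum_ltn_const.
by move=> j _; have hj := ltn_ord j; congr nat_of_bool; lia.
Qed.

End BoundedOperators.

(** * Limits of bounded sequences along an ultrafilter *)

Section UltraLimits.
Variables (R : realType) (U : set_system nat).
Hypothesis UF : UltraFilter U.

(** By compactness of [-C, C] the image filter has a cluster point; an ultrafilter contains each
    neighbourhood of it or the complement, and clustering excludes the complement. *)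
Lemma ultra_real_lim (v : nat -> R) (C : R) : (forall n, `|v n| <= C) ->
  exists c, forall e : R, 0 < e -> U [set n | `|v n - c| < e].
Proof.
move=> hv.
have FF : ProperFilter (v @ U) by exact: fmap_proper_filter.
have vU : (v @ U) `[- C, C]%classic.
  apply: (@filterS _ U _ setT) filterT => n _ /=; rewrite in_itv /=.
  by have := hv n; rewrite ler_norml.
have [c [_ clc]] := @segment_compact R (- C) C (v @ U) FF vU.
exists c => e e0.
have [//|hn] := in_ultra_setVsetC [set n | `|v n - c| < e] UF.
have hA : (v @ U) [set r | ~ `|r - c| < e] by exact: hn.
have hB : nbhs c [set r | `|r - c| < e].
  by apply/nbhs_ballP; exists e => //= r /=; rewrite /ball /= distrC.
by have [r []] := clc _ _ hA hB.
Qed.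

Lemma ultra_lim (u : nat -> R[i]) (C : R) : (forall n, cabs (u n) <= C) ->
  exists c : R[i], forall e : R, 0 < e -> U [set n | cabs (u n - c) < e].
Proof.
move=> hu.
have [a ha] := @ultra_real_lim (fun n => complex.Re (u n)) C
  (fun n => le_trans (Re_norm_le _) (hu n)).
have [b hb] := @ultra_real_lim (fun n => complex.Im (u n)) C
  (fun n => le_trans (Im_norm_le _) (hu n)).
exists (a +i* b)%C => e e0.
have e2 : 0 < e / 2 by rewrite divr_gt0.
apply: filterS2 (ha _ e2) (hb _ e2) => n /= h1 h2.
apply: le_lt_trans (cabs_le_ReIm _) _.
case: (u n) h1 h2 => p q /= h1 h2.
by rewrite [ltRHS](splitr e) ltrD.
Qed.

End UltraLimits.

(** Refining the filter at infinity makes all bounded sequences converge simultaneously, with no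
    subsequence to extract, while every tail remains a member. *)
Lemma exists_ultra_nat : exists U : set_system nat, UltraFilter U /\ \oo `<=` U.
Proof. exact: ultraFilterLemma eventually_filter. Qed.

(** * Continuous functions on a compact group with a dense orbit *)

Section ContinuousFunctions.
Variables (R : realType) (G : topologicalZmodType).
Implicit Types f g : G -> R[i].

Lemma ccontinuousP f : ccontinuous f <->
  forall x (e : R), 0 < e -> \forall y \near x, cabs (f y - f x) < e.
Proof.
by split=> h x e e0; have := h x e e0; apply: filterS => y; rewrite normE ltcR.
Qed.

Lemma ccontinuous_cst (c : R[i]) : ccontinuous (fun _ : G => c).
Proof.
apply/ccontinuousP => x e e0; apply: filterS filterT => y _.
by rewrite subrr cabs0.
Qed.

Lemma ccontinuousD f g : ccontinuous f -> ccontinuous g ->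
  ccontinuous (fun x => f x + g x).
Proof.
move=> /ccontinuousP hf /ccontinuousP hg; apply/ccontinuousP => x e e0.
have e2 : 0 < e / 2 by rewrite divr_gt0.
apply: filterS2 (hf x _ e2) (hg x _ e2) => y h1 h2.
rewrite opprD addrACA [ltRHS](splitr e).
exact: le_lt_trans (cabsD _ _) (ltrD _ _).
Qed.

Lemma ccontinuousM f g : ccontinuous f -> ccontinuous g ->
  ccontinuous (fun x => f x * g x).
Proof.
move=> /ccontinuousP hf /ccontinuousP hg; apply/ccontinuousP => x e e0.
pose F := cabs (f x); pose K := cabs (g x).
have F0 : 0 <= F := cabs_ge0 _; have K0 : 0 <= K := cabs_ge0 _.
have p1 : 0 < e / 2 / (F + 1) by rewrite !divr_gt0 // ltr_wpDl.
have p2 : 0 < e / 2 / (K + 1) by rewrite !divr_gt0 // ltr_wpDl.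
near=> y.
have -> : f y * g y - f x * g x = f y * (g y - g x) + (f y - f x) * g x by ring.
have h1 : cabs (g y - g x) < e / 2 / (F + 1) by near: y; exact: hg.
have h2 : cabs (f y - f x) < e / 2 / (K + 1) by near: y; exact: hf.
have h3 : cabs (f y - f x) < 1 by near: y; exact: hf.
have h4 : cabs (f y) <= F + 1.
  have -> : f y = f x + (f y - f x) by ring.
  by apply: le_trans (cabsD _ _) _; rewrite lerD // ltW.
apply: le_lt_trans (cabsD _ _) _; rewrite !cabsM [ltRHS](splitr e).
apply: ler_ltD.
  apply: (@le_trans _ _ ((F + 1) * (e / 2 / (F + 1)))).
    by apply: ler_pM; rewrite ?cabs_ge0 // ltW.
  by rewrite mulrC divfK // gt_eqF // ltr_wpDl.
apply: (@le_lt_trans _ _ (e / 2 / (K + 1) * K)).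
  by rewrite ler_wpM2r // ltW.
rewrite mulrAC ltr_pdivrMr ?ltr_wpDl // ltr_pM2l ?ltrDl //.
by rewrite divr_gt0.
Unshelve. all: end_near. Qed.

Lemma ccontinuousZ (c : R[i]) f : ccontinuous f -> ccontinuous (fun x => c * f x).
Proof. exact: (ccontinuousM (ccontinuous_cst c)). Qed.

Lemma ccontinuousB f g : ccontinuous f -> ccontinuous g ->
  ccontinuous (fun x => f x - g x).
Proof.
move=> hf hg; have := ccontinuousD hf (ccontinuousZ (-1) hg).
by congr ccontinuous; apply/funext => x; rewrite mulN1r.
Qed.

Lemma ccontinuousJ f : ccontinuous f -> ccontinuous (fun x => (f x)^*%C).
Proof.
move=> /ccontinuousP hf; apply/ccontinuousP => x e e0.
by apply: filterS (hf x e e0) => y; rewrite -rmorphB /= cabsJ.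
Qed.

Lemma ccontinuous_sum (I : Type) (r : seq I) (F : I -> G -> R[i]) :
  (forall i, ccontinuous (F i)) -> ccontinuous (fun x => \sum_(i <- r) F i x).
Proof.
move=> hF; elim: r => [|i r IH].
  by rewrite (_ : (fun=> _) = fun=> 0); [exact: ccontinuous_cst|];
     apply/funext => x; rewrite big_nil.
rewrite (_ : (fun=> _) = (fun x => F i x + \sum_(j <- r) F j x)).
  exact: ccontinuousD.
by apply/funext => x; rewrite big_cons.
Qed.

Lemma add_cvg (x y : G) : (p.1 + p.2) @[p --> (x, y)] --> x + y.
Proof. exact: (@add_continuous G (x, y)). Qed.

Lemma addr_cont (a : G) : continuous (fun x : G => x + a).
Proof.
move=> x; apply: (@continuous_comp _ _ _ (fun x : G => (x, a))
   (fun p : G * G => p.1 + p.2)); last exact: add_continuous.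
by apply: cvg_pair; [exact: cvg_id | exact: cvg_cst].
Qed.

Lemma ccontinuous_trans (a : G) f : ccontinuous f -> ccontinuous (fun x => f (x + a)).
Proof. by move=> hf x e e0; exact: (@addr_cont a x _ (hf (x + a) e e0)). Qed.

Lemma near_translate (P : G -> Prop) (x : G) : (\forall w \near (0 : G), P w) ->
  \forall y \near x, P (y - x).
Proof.
by move=> h; apply: (@addr_cont (- x) x P); rewrite subrr.
Qed.

Section Compact.
Hypothesis hcompact : compact [set: G].

Lemma compact_forall_near (I : Type) (F : set_system I) (P : I -> G -> Prop) :
  Filter F -> (forall x : G, \forall x' \near x & i \near F, P i x') ->
  \forall i \near F, forall x, P i x.
Proof.
move=> FF h; have /compact_near_coveringP hc := hcompact.
have := hc I F P FF (fun x _ => h x).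
by apply: filterS => i hi x; exact: hi.
Qed.

Lemma ccontinuous_bounded f : ccontinuous f ->
  exists2 C : R, 0 < C & forall x, cabs (f x) <= C.
Proof.
move=> /ccontinuousP hf.
have h : \forall C \near (+oo : set_system R), forall x, cabs (f x) <= C.
  apply: compact_forall_near => x.
  exists ([set y | cabs (f y - f x) < 1], [set C | cabs (f x) + 1 < C]).
    split; first exact: hf.
    by apply: nbhs_pinfty_gt; exact: num_real.
  move=> [y C] [/= h1 h2].
  have -> : f y = f x + (f y - f x) by ring.
  by apply: le_trans (cabsD _ _) _; apply: ltW; apply: le_lt_trans h2; rewrite lerD // ltW.
have h0 : \forall C \near (+oo : set_system R), 0 < C.
  by apply: nbhs_pinfty_gt; exact: num_real.
near (+oo : set_system R) => C.
exists C; first by near: C.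
by near: C.
Unshelve. all: end_near. Qed.

Lemma ccontinuous_unif f (e : R) : ccontinuous f -> 0 < e ->
  \forall w \near (0 : G), forall x, cabs (f (x + w) - f x) < e.
Proof.
move=> /ccontinuousP hf e0; have e2 : 0 < e / 2 by rewrite divr_gt0.
apply: compact_forall_near => x.
have h1 : \forall p \near (x, 0 : G), cabs (f (p.1 + p.2) - f x) < e / 2.
  apply: (@add_cvg x 0 [set z | cabs (f z - f x) < e / 2]).
  by rewrite addr0; exact: hf.
have h2 : \forall p \near (x, 0 : G), cabs (f p.1 - f x) < e / 2.
  by apply: (@cvg_fst _ _ (nbhs x) (nbhs (0 : G)) _ [set z | cabs (f z - f x) < e / 2]); exact: hf.
have h3 : \forall p \near (x, 0 : G), cabs (f (p.1 + p.2) - f p.1) < e.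
  apply: filterS2 h1 h2 => p p1 p2; rewrite [ltRHS](splitr e).
  apply: le_lt_trans (cabs_dist_add _ _ (f x)) _.
  by rewrite [X in _ + X]cabs_distC ltrD.
exact: h3.
Qed.

Section Dense.
Variable x1 : G.
Hypothesis hdense : closure (range (fun n : int => x1 *~ n)) = [set: G].

Lemma orbit_near (x : G) (P : G -> Prop) : (\forall y \near x, P y) ->
  exists n : int, P (x1 *~ n).
Proof.
move=> h; have : closure (range (fun n : int => x1 *~ n)) x by rewrite hdense.
by move=> /(_ _ h) [_ [[n _ <-]] ?]; exists n.
Qed.

Lemma cabs_le_orbit f (e : R) : ccontinuous f ->
  (forall n : int, cabs (f (x1 *~ n)) <= e) -> forall x, cabs (f x) <= e.
Proof.
move=> /ccontinuousP hf h x; apply/ler_addgt0Pr => d d0.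
have [n hn] := orbit_near (hf x d d0).
have -> : f x = f (x1 *~ n) + - (f (x1 *~ n) - f x) by ring.
by apply: le_trans (cabsD _ _) _; rewrite lerD // cabsN ltW.
Qed.

(** Density is what makes matrix entries sufficient: they only provide the values f(x_l). *)
Lemma eq_orbit f g : ccontinuous f -> ccontinuous g ->
  (forall n : int, f (x1 *~ n) = g (x1 *~ n)) -> f = g.
Proof.
move=> hf hg h; apply/funext => x; apply/eqP; rewrite -subr_eq0 -cabs_eq0.
rewrite eq_le cabs_ge0 andbT.
apply: (@cabs_le_orbit (fun x => f x - g x)); first exact: ccontinuousB.
by move=> n; rewrite h subrr cabs0.
Qed.

(** By density the orbit translates of the interior of [W] cover G; by compactness finitely many
    suffice, and [L] bounds their indices. *)
Lemma syndetic (W : G -> Prop) : (\forall w \near (0 : G), W w) ->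
  exists L : nat, forall x, exists n : int, (`|n| <= L)%N /\ W (x - x1 *~ n).
Proof.
move=> hW.
have h : \forall L \near \oo, forall x, exists n : int, (`|n| <= L)%N /\ W (x - x1 *~ n).
  apply: compact_forall_near => x.
  have c : continuous (fun y : G => x - y).
    move=> y; apply: (@continuous_comp _ _ _ (fun y : G => (x, y))
      (fun p : G * G => p.1 - p.2)); last exact: sub_continuous.
    by apply: cvg_pair; [exact: cvg_cst | exact: cvg_id].
  (* [W] is asked to be a neighbourhood of x - y, not merely to contain it, so that the same n still
     serves all points near x. *)
  have hx : \forall y \near x, nbhs (x - y) W.
    apply: (c x [set z | nbhs z W]); rewrite subrr.
    exact: near_join.
  have [n hn] := orbit_near hx.
  exists ([set y | W (y - x1 *~ n)], [set L | (`|n| <= L)%N]).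
    split => /=; last by exists `|n|%N.
    exact: (@addr_cont (- (x1 *~ n)) x W).
  by move=> [y L] [/= h1 h2]; exists n.
near \oo => L; exists L; near: L; exact: h.
Unshelve. all: end_near. Qed.
End Dense.
End Compact.
End ContinuousFunctions.

(** * Averages along the orbit: eigenfunctions, means, coboundaries *)

Section Averages.
Variables (R : realType) (G : topologicalZmodType).
Hypothesis hcompact : compact [set: G].
Variable x1 : G.
Hypothesis hdense : closure (range (fun n : int => x1 *~ n)) = [set: G].
Implicit Types f g h : G -> R[i].

(** There are N + 1 terms, so the divisor never vanishes; z = 1 gives the Birkhoff averages of
    [f]. *)
Definition twisted_avg f (z : R[i]) (N : nat) : G -> R[i] := fun x =>
  N.+1%:R^-1 * \sum_(l < N.+1) z ^+ l * f (x + x1 *+ l).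

Lemma cabs_avg_le (N : nat) (F : 'I_N.+1 -> R[i]) (C : R) :
  (forall i, cabs (F i) <= C) -> cabs (N.+1%:R^-1 * \sum_i F i) <= C.
Proof.
move=> hF; rewrite cabsM cabsV cabs_nat mulrC ler_pdivrMr ?ltr0n //.
apply: le_trans (cabs_sum _ _ _) _.
apply: le_trans (ler_sum _ (fun i _ => hF i)) _.
by rewrite sumr_const card_ord mulr_natr.
Qed.

(** Multiplying by [z] and translating by x_1 shifts the summation index by one. What remains are
    two boundary terms divided by N + 1, so limits of the averages are eigenfunctions. *)
Lemma twisted_avg_step f z N x :
  z * twisted_avg f z N (x + x1) =
  twisted_avg f z N x + N.+1%:R^-1 * (z ^+ N.+1 * f (x + x1 *+ N.+1) - f x).
Proof.
rewrite /twisted_avg -mulrDr mulrCA; congr (_ * _); rewrite mulr_sumr.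
rewrite (eq_bigr (fun l : 'I_N.+1 => z ^+ l.+1 * f (x + x1 *+ l.+1))); last first.
  by move=> l _; rewrite mulrA -exprS -addrA -mulrS.
rewrite big_ord_recr [in RHS]big_ord_recl /= expr0 mul1r mulr0n addr0.
under [X in _ = _ + X + _]eq_bigr do rewrite /bump leq0n add1n.
by ring.
Qed.

(* Ascoli's theorem along an ultrafilter: the averages are equicontinuous, so
   their pointwise ultralimit is continuous and is approached uniformly. *)
Lemma twisted_avg_limit f (z : nat -> R[i]) (r : nat -> nat) : ccontinuous f ->
  (forall n, cabs (z n) = 1) -> (forall n, n <= r n)%N ->
  exists (h : G -> R[i]) (lam : R[i]), [/\ ccontinuous h, cabs lam = 1,
    (forall x, lam * h (x + x1) = h x) &
    forall (e : R) (M : nat), 0 < e -> exists2 N, (M <= N)%N &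
      cabs (z N - lam) < e /\ forall x, cabs (twisted_avg f (z N) (r N) x - h x) <= e].
Proof.
move=> cf z1 hr; have [U [UF ooU]] := exists_ultra_nat.
have [C C0 fC] := ccontinuous_bounded hcompact cf.
have [lam hlam] := @ultra_lim R U UF z 1 (fun n => ltac:(by rewrite z1)).
have AC N x : cabs (twisted_avg f (z N) (r N) x) <= C.
  by apply: cabs_avg_le => i; rewrite cabsM cabsX z1 expr1n mul1r.
have /choice [h hh] : forall x, exists c : R[i], forall e : R, 0 < e ->
    U [set N | cabs (twisted_avg f (z N) (r N) x - c) < e].
  by move=> x; apply: ultra_lim => // N; exact: AC.
(* Since |z| = 1, the averages inherit the modulus of continuity of [f], uniformly in N. *)
have equi (e : R) : 0 < e -> \forall w \near (0 : G), forall x N,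
    cabs (twisted_avg f (z N) (r N) (x + w) - twisted_avg f (z N) (r N) x) <= e.
  move=> e0; have := ccontinuous_unif hcompact cf e0; apply: filterS => w hw x N.
  rewrite /twisted_avg -mulrBr -sumrB; apply: cabs_avg_le => i.
  rewrite -mulrBr cabsM cabsX z1 expr1n mul1r addrAC; exact/ltW/hw.
have hequi (e : R) : 0 < e -> \forall w \near (0 : G), forall x,
    cabs (h (x + w) - h x) <= e.
  move=> e0; have e3 : 0 < e / 3 by rewrite divr_gt0.
  have := equi _ e3; apply: filterS => w hw x.
  have [N [/= h1 h2]] := filter_ex (filterI (hh (x + w) _ e3) (hh x _ e3)).
  have h3 := hw x N.
  apply: le_trans (cabs_dist_add _ _ (twisted_avg f (z N) (r N) (x + w))) _.
  apply: le_trans (lerD (lexx _) (cabs_dist_add _ _ (twisted_avg f (z N) (r N) x))) _.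
  by rewrite cabs_distC; lra.
have hc : ccontinuous h.
  apply/ccontinuousP => x e e0.
  have e2 : 0 < e / 2 by rewrite divr_gt0.
  have := near_translate x (hequi _ e2); apply: filterS => y /(_ x).
  by rewrite subrKC => /le_lt_trans; apply; lra.
have lam1 : cabs lam = 1.
  apply/eqP; rewrite eq_sym -subr_eq0 -normr_le0; apply/ler_addgt0Pr => e e0.
  rewrite add0r; have [N /= hN] := filter_ex (hlam e e0).
  rewrite -(z1 N) ler_norml; apply/andP; split.
    have := cabsD (z N) (lam - z N); rewrite subrKC (cabs_distC lam); lra.
  have := cabsD lam (z N - lam); rewrite subrKC; lra.
have unif (e : R) : 0 < e -> U [set N | forall x, cabs (twisted_avg f (z N) (r N) x - h x) <= e].
  move=> e0; have e3 : 0 < e / 3 by rewrite divr_gt0.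
  apply: (compact_forall_near hcompact
    (P := fun N x => cabs (twisted_avg f (z N) (r N) x - h x) <= e)) => x.
  exists ([set y | cabs (h y - h x) <= e / 3 /\
       forall N, cabs (twisted_avg f (z N) (r N) y - twisted_avg f (z N) (r N) x) <= e / 3],
     [set N | cabs (twisted_avg f (z N) (r N) x - h x) < e / 3]).
    split => /=; last exact: hh.
    apply: filterS (near_translate x (filterI (hequi _ e3) (equi _ e3))) => y /= [h1 h2]; split=> [|N].
      by have := h1 x; rewrite subrKC.
    by have := h2 x N; rewrite subrKC.
  move=> [y N] [/= [h1 h2] h3]; have {}h2 := h2 N.
  apply: le_trans (cabs_dist_add _ _ (twisted_avg f (z N) (r N) x)) _.
  apply: le_trans (lerD (lexx _) (cabs_dist_add _ _ (h x))) _.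
  by rewrite (cabs_distC (h x)); lra.
exists h, lam; split => //; last first.
  move=> e M e0.
  have hM : U [set N | (M <= N)%N] by apply: ooU; exact: nbhs_infty_ge.
  have [N [[/= h1 h2] h3]] := filter_ex (filterI (filterI (hlam e e0) (unif e e0)) hM).
  by exists N.
move=> x; apply/eqP; rewrite -subr_eq0 -cabs_eq0 eq_le cabs_ge0 andbT.
apply/ler_addgt0Pr => e e0; rewrite add0r.
pose K := cabs (h (x + x1)); have K0 : 0 <= K := cabs_ge0 _.
have p1 : 0 < e / 4 / (K + 1) by rewrite !divr_gt0 // ltr_wpDl.
have e4 : 0 < e / 4 by rewrite divr_gt0.
(* For N >= M the boundary term of [twisted_avg_step], at most 2C/(r N + 1), is below e/4; this uses
   N <= r N. *)
pose M := Num.truncn (2 * C / (e / 4)).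
have hM : U [set N | (M <= N)%N] by apply: ooU; exact: nbhs_infty_ge.
have [N [[/= h1 h2] h3]] := filter_ex (filterI (filterI (hlam _ p1) (unif _ e4)) hM).
have k1 : cabs ((lam - z N) * h (x + x1)) <= e / 4.
  rewrite cabsM cabs_distC.
  apply: (@le_trans _ _ (e / 4 / (K + 1) * (K + 1))).
    by apply: ler_pM; rewrite ?cabs_ge0 ?(ltW h1) // lerDl.
  by rewrite divfK // gt_eqF // ltr_wpDl.
have k2 : cabs (z N * (h (x + x1) - twisted_avg f (z N) (r N) (x + x1))) <= e / 4.
  by rewrite cabsM z1 mul1r cabs_distC.
have k3 : cabs ((r N).+1%:R^-1 * (z N ^+ (r N).+1 * f (x + x1 *+ (r N).+1) - f x)) <= e / 4.
  rewrite cabsM cabsV cabs_nat mulrC ler_pdivrMr ?ltr0n //.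
  apply: (@le_trans _ _ (2 * C)).
    apply: le_trans (cabsD _ _) _; rewrite cabsN cabsM cabsX z1 expr1n mul1r.
    by have := fC (x + x1 *+ (r N).+1); have := fC x; lra.
  rewrite -ler_pdivrMl // [leLHS]mulrC; apply: ltW.
  have : 2 * C / (e / 4) < M.+1%:R by exact: truncnS_gt.
  by move=> /lt_le_trans; apply; rewrite ler_nat ltnS (leq_trans h3).
have k4 := h2 x.
have -> : lam * h (x + x1) - h x = (lam - z N) * h (x + x1)
  + (z N * (h (x + x1) - twisted_avg f (z N) (r N) (x + x1))
  + ((z N * twisted_avg f (z N) (r N) (x + x1) - twisted_avg f (z N) (r N) x)
     + (twisted_avg f (z N) (r N) x - h x))) by ring.
rewrite twisted_avg_step [_ + _ * _ - _]addrAC subrr add0r.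
apply: le_trans (cabsD _ _) _; rewrite [leRHS](_ : e = e / 4 + (e / 4 + (e / 4 + e / 4))); last by lra.
apply: lerD => //; apply: le_trans (cabsD _ _) _; apply: lerD => //.
by apply: le_trans (cabsD _ _) _; apply: lerD.
Qed.

(** The number c is then the Haar integral of [f], described here through coboundaries instead of a
    measure. *)
Definition has_mean f (c : R[i]) := forall e : R, 0 < e ->
  exists2 u : G -> R[i], ccontinuous u &
    forall x, cabs (f x - c - (u (x + x1) - u x)) <= e.

Lemma invariant_cst h : ccontinuous h -> (forall x, h (x + x1) = h x) ->
  forall x, h x = h 0.
Proof.
move=> ch hi.
have hn (n : nat) x : h (x + x1 *+ n) = h x.
  by elim: n => [|n IH]; rewrite ?mulr0n ?addr0 // mulrSr addrA hi.
move=> x; have -> // := @eq_orbit R G x1 hdense h (fun=> h 0) ch (ccontinuous_cst _).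
case=> n; first by rewrite -[in LHS](add0r (x1 *~ n)) hn.
by rewrite NegzE mulrNz -(hn n.+1 (- _)) addNr.
Qed.

(** The difference between [f] and its Birkhoff average is itself a coboundary, and the averages
    come uniformly close to an invariant continuous function, which is constant by density. *)
Lemma exists_mean f : ccontinuous f -> exists c, has_mean f c.
Proof.
move=> cf.
have [h [lam [ch _ hlam hN]]] := @twisted_avg_limit f (fun=> 1) id cf (fun=> cabs1 R) (fun=> leqnn _).
have lam1 : lam = 1.
  apply/eqP; rewrite eq_sym -subr_eq0 -cabs_eq0 eq_le cabs_ge0 andbT.
  apply/ler_addgt0Pr => e e0; rewrite add0r.
  by have [N _ [h1 _]] := hN e 0%N e0; exact: ltW.
have hcst := invariant_cst ch (fun x => ltac:(by have := hlam x; rewrite lam1 mul1r)).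
exists (h 0) => e e0; have [N _ [_ hA]] := hN e 0%N e0.
(* The coboundary of this function at x is the average over l of f(x) - f(x + x_l), because the
   inner sums telescope. *)
exists (fun x => - N.+1%:R^-1 * \sum_(l < N.+1) \sum_(j < l) f (x + x1 *+ j)).
  apply: ccontinuousZ; apply: ccontinuous_sum => l.
  by apply: ccontinuous_sum => j; exact: ccontinuous_trans.
move=> x; apply: le_trans (hA x); rewrite hcst.
suff -> : f x - h 0 - (- N.+1%:R^-1 * (\sum_(l < N.+1) \sum_(j < l) f (x + x1 + x1 *+ j)) -
  - N.+1%:R^-1 * (\sum_(l < N.+1) \sum_(j < l) f (x + x1 *+ j))) =
  twisted_avg f 1 N x - h 0 by [].
rewrite -mulrBr -sumrB.
rewrite (eq_bigr (fun l : 'I_N.+1 => 1 ^+ l * f (x + x1 *+ l) - f x)); last first.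
  move=> l _; rewrite expr1n mul1r.
  elim: (nat_of_ord l) => [|m IH]; first by rewrite !big_ord0 mulr0n addr0 !subrr.
  rewrite !big_ord_recr /= opprD addrACA IH.
  by rewrite -[x + x1 + _]addrA -mulrS; ring.
rewrite sumrB sumr_const card_ord /twisted_avg mulNr mulrBr -(mulr_natl (f x)) mulrA.
by rewrite mulVf ?pnatr_eq0 // mul1r; ring.
Qed.

(* Averaging along the orbit kills coboundaries. *)
Lemma has_mean_unique (a : int -> R[i]) (c c' : R[i]) :
  (forall e : R, 0 < e -> exists2 u : G -> R[i], ccontinuous u &
    forall n : int, cabs (a n - c - (u (x1 *~ (n + 1)) - u (x1 *~ n))) <= e) ->
  (forall e : R, 0 < e -> exists2 u : G -> R[i], ccontinuous u &
    forall n : int, cabs (a n - c' - (u (x1 *~ (n + 1)) - u (x1 *~ n))) <= e) ->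
  c = c'.
Proof.
move=> h h'; apply/eqP; rewrite -subr_eq0 -cabs_eq0 eq_le cabs_ge0 andbT.
apply/ler_addgt0Pr => e e0; rewrite add0r.
have e4 : 0 < e / 4 by rewrite divr_gt0.
have [u cu hu] := h _ e4; have [u' cu' hu'] := h' _ e4.
have [K K0 hK] := ccontinuous_bounded hcompact (ccontinuousB cu cu').
(* Averaging over M + 1 orbit points leaves a telescoped term of modulus at most 2K/(M + 1), which
   is below e/2. *)
pose M := Num.truncn (2 * K / (e / 2)).
have e2 : 0 < e / 2 by rewrite divr_gt0.
pose v x := u x - u' x.
have k1 (n : int) : cabs (c - c' + (v (x1 *~ (n + 1)) - v (x1 *~ n))) <= e / 2.
  have -> : c - c' + (v (x1 *~ (n + 1)) - v (x1 *~ n)) =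
     (a n - c' - (u' (x1 *~ (n + 1)) - u' (x1 *~ n)))
     - (a n - c - (u (x1 *~ (n + 1)) - u (x1 *~ n))) by rewrite /v; ring.
  apply: le_trans (cabsD _ _) _; rewrite cabsN.
  by have := hu n; have := hu' n; lra.
have k2 : cabs (M.+1%:R^-1 * \sum_(n < M.+1)
    (c - c' + (v (x1 *~ (n%:Z + 1)) - v (x1 *~ n%:Z)))) <= e / 2.
  by apply: cabs_avg_le => i.
have tel : \sum_(n < M.+1) (v (x1 *~ (n%:Z + 1)) - v (x1 *~ n%:Z)) = v (x1 *~ M.+1%:Z) - v 0.
  elim: M.+1 => [|m IH]; first by rewrite big_ord0 mulr0z subrr.
  rewrite big_ord_recr /= IH (_ : m%:Z + 1 = m.+1%:Z); first by ring.
  by rewrite -addn1 PoszD.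
rewrite big_split /= tel sumr_const card_ord mulrDr -(mulr_natl (c - c')) mulrA in k2.
rewrite mulVf ?pnatr_eq0 // mul1r in k2.
have k3 : cabs (M.+1%:R^-1 * (v (x1 *~ M.+1%:Z) - v 0)) <= e / 2.
  rewrite cabsM cabsV cabs_nat mulrC ler_pdivrMr ?ltr0n //.
  apply: (@le_trans _ _ (2 * K)).
    apply: le_trans (cabsD _ _) _; rewrite cabsN.
    by have := hK (x1 *~ M.+1%:Z); have := hK 0; rewrite -/(v _) -/(v 0); lra.
  rewrite -ler_pdivrMl // [leLHS]mulrC; apply: ltW; exact: truncnS_gt.
rewrite -[c - c'](addrK (M.+1%:R^-1 * (v (x1 *~ M.+1%:Z) - v 0))).
by apply: le_trans (cabsD _ _) _; rewrite cabsN (splitr e) lerD.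
Qed.

(** Translation by x_n multiplies [h] by a number of modulus 1, whatever the starting point. So
    multiplicativity in the second summand and modulus 1 hold along the orbit for h / h(0), and
    density extends both to G. *)
Lemma eigenfunction_char h lam : ccontinuous h -> cabs lam = 1 ->
  (forall x, lam * h (x + x1) = h x) -> h 0 != 0 ->
  is_character (fun x => h x / h 0) /\
  forall n : nat, h (x1 *+ n) / h 0 = lam ^- n.
Proof.
move=> ch lam1 hl h0.
have l0 : lam != 0 by rewrite -cabs_eq0 lam1 oner_eq0.
have hn (n : nat) x : h (x + x1 *+ n) = lam ^- n * h x.
  elim: n => [|n IH]; first by rewrite mulr0n addr0 expr0 invr1 mul1r.
  apply: (mulfI l0); rewrite mulrSr addrA hl IH exprS invfM mulrA.
  by rewrite mulrA mulfV // mul1r.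
have hz (n : int) : exists2 m : R[i], cabs m = 1 & forall x, h (x + x1 *~ n) = m * h x.
  case: n => n.
    by exists (lam ^- n) => [|x]; [rewrite cabsV cabsX lam1 expr1n invr1|exact: hn].
  exists (lam ^+ n.+1); first by rewrite cabsX lam1 expr1n.
  move=> x; have := hn n.+1 (x + x1 *~ Negz n).
  rewrite NegzE mulrNz addrNK => ->.
  by rewrite mulrA mulfV ?mul1r // expf_neq0.
have cx : ccontinuous (fun x => h x / h 0).
  by have := ccontinuousZ (h 0)^-1 ch; congr ccontinuous; apply/funext => x; rewrite mulrC.
split; last by move=> n; rewrite -[x1 *+ n]add0r hn mulfK.
split => //.
- move=> x y.
  have c2 : ccontinuous (fun y => h x / h 0 * (h y / h 0)) by exact: ccontinuousZ.
  have c1 : ccontinuous (fun y => h (x + y) / h 0).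
    have := ccontinuous_trans x cx; congr ccontinuous.
    by apply/funext => z; rewrite addrC.
  have := @eq_orbit R G x1 hdense _ _ c1 c2; move=> /(_ _)/(congr1 (fun F => F y)); apply.
  move=> n; have [m _ hm] := hz n; rewrite hm -[x1 *~ n]add0r hm mulfK //.
  by rewrite -mulrA mulrC.
- move=> x.
  have c1 : ccontinuous (fun y => (h y / h 0) * (h y / h 0)^*%C).
    by apply: ccontinuousM => //; exact: ccontinuousJ.
  have := @eq_orbit R G x1 hdense _ _ c1 (ccontinuous_cst 1).
  move=> /(_ _)/(congr1 (fun F => F x)) /=; rewrite mulcJ => e.
  have {}e : (cabs (h x / h 0) ^+ 2)%:C%C = 1 :> R[i].
    apply: e => n; have [m m1 hm] := hz n.
    by rewrite mulcJ -[x1 *~ n]add0r hm mulfK // m1 expr1n.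
  have e2 : cabs (h x / h 0) ^+ 2 = 1 by apply: complexI; rewrite e.
  rewrite normE; congr (_%:C)%C; apply/eqP.
  by rewrite -(@eqrXn2 _ 2) ?cabs_ge0 // e2 expr1n.
Qed.
End Averages.

(** * Finite Fourier analysis on Z/M *)

Section FiniteFourier.
Variable R : realType.

Lemma exists_prim_root n : (0 < n)%N -> exists z : R[i], n.-primitive_root z.
Proof.
move=> n0; have [s es] := closed_field_poly_normal ('X^n - 1 : {poly R[i]}).
have {}es : 'X^n - 1 = \prod_(z <- s) ('X - z%:P).
  by rewrite es lead_coefDl ?lead_coefXn ?scale1r // size_polyXn size_polyN size_poly1.
have us : uniq s.
  by rewrite -separable_prod_XsubC -es separable_Xn_sub_1 // pnatr_eq0 -lt0n.
have rs : all n.-unity_root s.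
  by apply/allP => z zs; rewrite /root_of_unity es root_prod_XsubC.
have ss : (n <= size s)%N.
  by rewrite -ltnS -(size_prod_XsubC s id) -es size_XnsubC.
by have /hasP[z _ pz] := has_prim_root n0 rs us ss; exists z.
Qed.

Lemma prim_root_cabs n (z : R[i]) : n.-primitive_root z -> cabs z = 1.
Proof.
move=> pz; have n0 := prim_order_gt0 pz.
apply/eqP; rewrite -(@eqrXn2 _ n) ?cabs_ge0 // -cabsX (prim_expr_order pz).
by rewrite cabs1 expr1n.
Qed.

Lemma prim_root_ortho M (z : R[i]) (p q : nat) : M.-primitive_root z ->
  (p < M)%N -> (q < M)%N ->
  \sum_(j < M) (z ^+ j) ^+ p * ((z ^+ j) ^+ q)^*%C = (p == q)%:R * M%:R.
Proof.
move=> pz pM qM; have z1 := prim_root_cabs pz.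
pose w := z ^+ p * (z ^+ q)^*%C.
have zq1 : z ^+ q * (z ^+ q)^*%C = 1 by rewrite mulcJ cabsX z1 !expr1n.
rewrite (eq_bigr (fun j : 'I_M => w ^+ j)); last first.
  by move=> j _; rewrite /w exprMn -!exprM -rmorphXn /= -exprM !(mulnC j).
have [epq|npq] := eqVneq p q.
  rewrite (eq_bigr (fun=> 1)); last first.
    by move=> j _; rewrite /w epq mulcJ cabsX z1 !expr1n.
  by rewrite sumr_const card_ord mul1r.
have wM : w ^+ M = 1.
  rewrite /w exprMn -rmorphXn /= -!exprM ![(_ * M)%N]mulnC !exprM (prim_expr_order pz).
  by rewrite !expr1n rmorph1 mulr1.
have w1 : w != 1.
  apply/eqP => e; move/eqP: npq; apply.
  have : z ^+ p = z ^+ q.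
    by rewrite -[RHS]mul1r -e /w -mulrA [X in _ * X]mulrC zq1 mulr1.
  by move/eqP; rewrite (eq_prim_root_expr pz) !modn_small // => /eqP.
have : (w - 1) * \sum_(j < M) w ^+ j = 0 by rewrite -subrX1 wM subrr.
move/eqP; rewrite mulf_eq0 subr_eq0 (negPf w1) /= => /eqP ->.
by rewrite mul0r.
Qed.

(** Orthogonality for a vector placed at the distinct exponents [s i]. Besides s = id, it is applied
    to exponents that are almost periods and need not be consecutive. *)
Lemma plancherel M (z : R[i]) (N : nat) (a : nat -> R[i]) (s : nat -> nat) :
  M.-primitive_root z -> (forall i, (i < N)%N -> (s i < M)%N) ->
  (forall i j, (i < N)%N -> (j < N)%N -> s i = s j -> i = j) ->
  \sum_(j < M) cabs (\sum_(i < N) a i * (z ^+ j) ^+ s i) ^+ 2 =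
  M%:R * \sum_(i < N) cabs (a i) ^+ 2.
Proof.
move=> pz sM sinj; apply: complexI.
rewrite rmorph_sum rmorphM rmorph_sum rmorph_nat /=.
under eq_bigr do rewrite -mulcJ rmorph_sum /= big_distrl /=.
rewrite exchange_big /= mulr_sumr; apply: eq_bigr => i _.
under eq_bigr do rewrite mulr_sumr.
rewrite exchange_big /= (bigD1 i) //= [X in _ + X]big1 ?addr0.
  under eq_bigr do rewrite rmorphM /= mulrACA.
  rewrite -mulr_sumr prim_root_ortho ?sM // eqxx mul1r mulcJ.
  by rewrite mulrC rmorphXn.
move=> k /eqP ki; under eq_bigr do rewrite rmorphM /= mulrACA.
rewrite -mulr_sumr prim_root_ortho ?sM //.
case: eqP => [e|]; last by rewrite mul0r mulr0.
by case: ki; apply: val_inj; exact: (sinj _ _ (ltn_ord _) (ltn_ord _) (esym e)).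
Qed.

(* Trigonometric sums of an almost periodic sequence cannot all be small:
   the correlations along the almost periods [k] are detected by them. *)
Lemma correlation_bound (a : nat -> R[i]) (k : nat -> nat) (N Q M : nat) (s : R) :
  (0 < M)%N -> (forall i, (i < Q)%N -> (k i + N <= M)%N) -> (0 < N)%N ->
  (forall i j, (i < Q)%N -> (j < Q)%N -> k i = k j -> i = j) -> 0 <= s ->
  (forall z : R[i], cabs z = 1 -> cabs (\sum_(l < N) a l * z ^+ l) <= s) ->
  (0 < Q)%N ->
  complex.Re (\sum_(i < Q) \sum_(l < N)
      (if (l + k i < N)%N then a l * (a (l + k i)%N)^*%C else 0)) <=
  s / 2 * (\sum_(l < N) cabs (a l) ^+ 2 + Q%:R).
Proof.
move=> M0 kM N0 kinj s0 hs Q0; have [z pz] := exists_prim_root M0.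
have NM : (N <= M)%N by apply: leq_trans (kM 0%N Q0); exact: leq_addl.
pose S j : R[i] := \sum_(l < N) a l * (z ^+ j) ^+ l.
pose K j : R[i] := \sum_(i < Q) 1 * (z ^+ j) ^+ k i.
have M1 : 0 < M%:R :> R by rewrite ltr0n.
(* Orthogonality keeps only m = l + k i. There is no wraparound modulo M, because k i + N <= M
   forces l + k i < M. *)
have triple : \sum_(j < M) S j * K j * (S j)^*%C = M%:R *
   \sum_(i < Q) \sum_(l < N)
      (if (l + k i < N)%N then a l * (a (l + k i)%N)^*%C else 0).
  under eq_bigr do rewrite /K mulr_sumr big_distrl /=.
  rewrite exchange_big /= mulr_sumr; apply: eq_bigr => i _.
  under eq_bigr do rewrite /S big_distrl big_distrl /=.
  rewrite exchange_big /= mulr_sumr; apply: eq_bigr => l _.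
  under eq_bigr do rewrite rmorph_sum /= mulr_sumr.
  rewrite exchange_big /=.
  have e m : \sum_(j < M) a l * (z ^+ j) ^+ l * (1 * (z ^+ j) ^+ k i) *
     (a m * (z ^+ j) ^+ m)^*%C = a l * (a m)^*%C *
      \sum_(j < M) (z ^+ j) ^+ (l + k i)%N * ((z ^+ j) ^+ m)^*%C.
    rewrite mulr_sumr; apply: eq_bigr => j _; rewrite rmorphM /= exprD; ring.
  have lM : (l + k i < M)%N.
    by apply: leq_trans (kM i (ltn_ord i)); have := ltn_ord l; lia.
  case: ifP => h; last first.
    rewrite mulr0; apply: big1 => m _; rewrite e prim_root_ortho //; last first.
      exact: leq_trans (ltn_ord m) NM.
    case: eqP => [e2|]; last by rewrite mul0r mulr0.
    by have := ltn_ord m; rewrite -e2 h.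
  rewrite (bigD1 (Ordinal h)) //= e prim_root_ortho // eqxx mul1r.
  rewrite big1 ?addr0; first by rewrite mulrC.
  move=> m /eqP mh; rewrite e prim_root_ortho //; last exact: leq_trans (ltn_ord m) NM.
  case: eqP => [e2|]; last by rewrite mul0r mulr0.
  by case: mh; apply/val_inj.
have pS : \sum_(j < M) cabs (S j) ^+ 2 = M%:R * \sum_(l < N) cabs (a l) ^+ 2.
  by apply: (@plancherel M z N a id pz) => [i iN|] //; exact: leq_trans iN NM.
have pK : \sum_(j < M) cabs (K j) ^+ 2 = M%:R * Q%:R.
  rewrite (@plancherel _ _ _ (fun=> 1) k pz) //.
    under eq_bigr do rewrite cabs1 expr1n.
    by rewrite sumr_const card_ord.
  by move=> i iQ; apply: leq_trans (kM i iQ); lia.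
rewrite -(ler_pM2l M1).
set T := \sum_(i < Q) _ in triple *.
have -> : M%:R * complex.Re T = complex.Re (M%:R * T).
  by rewrite mulr_natl mulr_natl raddfMn.
rewrite -triple.
apply: le_trans (Re_le_cabs _) _; apply: le_trans (cabs_sum _ _ _) _.
(* One factor |S| is bounded by [s]; the remaining product |S| |K| is split into squares, whose sums
   over [j] are [pS] and [pK]. *)
apply: (@le_trans _ _ (\sum_(j < M) (s / 2 * (cabs (S j) ^+ 2 + cabs (K j) ^+ 2)))).
  apply: ler_sum => j _; rewrite !cabsM cabsJ.
  have hS : cabs (S j) <= s by apply: hs; rewrite cabsX (prim_root_cabs pz) expr1n.
  set p := cabs (S j); set q := cabs (K j).
  have p0 : 0 <= p by exact: cabs_ge0.
  have q0 : 0 <= q by exact: cabs_ge0.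
  apply: (@le_trans _ _ (s * (p * q))).
    by rewrite mulrC ler_wpM2r // mulr_ge0.
  rewrite -mulrA; apply: ler_wpM2l => //.
  by have := sqr_ge0 (p - q); rewrite sqrrB -mulr_natr; lra.
rewrite -mulr_sumr big_split /= pS pK -mulrDr mulrCA; exact: lexx.
Qed.

End FiniteFourier.

(** * Characters separating the points of the orbit from 0 *)

Section Characters.
Variables (R : realType) (G : topologicalZmodType).
Hypothesis hcompact : compact [set: G].
Variable x1 : G.
Hypothesis hdense : closure (range (fun n : int => x1 *~ n)) = [set: G].
Implicit Types f g h : G -> R[i].

(** Start at the midpoint of a window of length 2L + 1: a correction by at most L steps, supplied by
    [syndetic], reaches a return time without leaving the window. *)
Lemma orbit_windows (W : G -> Prop) : (\forall w \near (0 : G), W w) ->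
  exists2 J : nat, (0 < J)%N & exists k : nat -> nat, forall i,
    (i * J <= k i < i.+1 * J)%N /\ W (x1 *+ k i).
Proof.
move=> hW; have [L hL] := syndetic hcompact hdense hW.
exists L.*2.+1 => //.
suff /choice [k hk] : forall i, exists k, (i * L.*2.+1 <= k < i.+1 * L.*2.+1)%N /\ W (x1 *+ k).
  by exists k.
move=> i; have [n [nL Wn]] := hL (x1 *+ (i * L.*2.+1 + L)).
exists `|(i * L.*2.+1 + L)%N%:Z - n|%N; split; first by rewrite mulSn; lia.
have -> : x1 *+ `|(i * L.*2.+1 + L)%N%:Z - n|%N = x1 *+ (i * L.*2.+1 + L) - x1 *~ n.
  rewrite -[x1 *+ (i * _ + L)]/(x1 *~ (i * L.*2.+1 + L)%N%:Z) -mulrzBr.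
  by rewrite -[LHS]/(x1 *~ `|_|%N%:Z) gez0_abs //; lia.
by [].
Qed.

Lemma windows_inj (B : nat) (k : nat -> nat) :
  (forall i, (i * B <= k i < i.+1 * B)%N) -> injective k.
Proof.
move=> hk i j e; have /andP[h1 h2] := hk i; have /andP[h3 h4] := hk j.
rewrite e in h1 h2; apply/eqP; rewrite eqn_leq -ltnS -(ltnS j).
have B0 : (0 < B)%N by move: (leq_ltn_trans h1 h2); case: (B); rewrite ?muln0.
apply/andP; split; rewrite -(ltn_pmul2r B0).
  exact: leq_ltn_trans h1 h4.
exact: leq_ltn_trans h3 h2.
Qed.

(** If all averages of length N were small, [correlation_bound] would make the correlations along
    almost periods small in total. But at an almost period k, f(x_(l+k)) is close to f(x_l), so each
    correlation is nearly a sum of |f(x_l)|^2; this is of order N, since |f| >= [c] at least once in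
    every window of length [J0]. The constants make the lower bound twice the upper one. *)
Lemma large_twisted_avg f : ccontinuous f -> f 0 != 0 ->
  exists2 e : R, 0 < e & forall M : nat, exists N (z : R[i]),
    [/\ (M <= N)%N, cabs z = 1 & e <= cabs (twisted_avg x1 f z N 0)].
Proof.
move=> cf f0; have [A A0 hA] := ccontinuous_bounded hcompact cf.
pose c := cabs (f 0) / 2.
have c0 : 0 < c by rewrite divr_gt0 // cabs_gt0.
have [J0 J0p [k0 hk0]] := orbit_windows (ccontinuous_unif hcompact cf c0).
have J0R : 0 < J0%:R :> R by rewrite ltr0n.
(* With N = 2 Q J J0, replacing f(x_(l+k)) by f(x_l) costs at most N eta A = Q J c^2 / 2, half of
   the main term Q J c^2. *)
pose eta := c ^+ 2 / (4 * A * J0%:R).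
have eta0 : 0 < eta by rewrite divr_gt0 ?exprn_gt0 // !mulr_gt0.
have [J Jp [k hk]] := orbit_windows (ccontinuous_unif hcompact cf eta0).
have JR : 0 < J%:R :> R by rewrite ltr0n.
(* For the length N chosen below, N A^2 + Q J0 = Q J0 D; so with [e] the upper bound becomes a
   quarter of (Q J0)(Q J c^2), against a half in the lower bound. *)
pose D := 2 * J%:R * A ^+ 2 + 1.
have D0 : 0 < D by rewrite ltr_wpDl // !mulr_ge0 ?sqr_ge0 // ltW.
pose e := c ^+ 2 / (4 * J0%:R * D).
exists e; first by rewrite divr_gt0 ?exprn_gt0 // !mulr_gt0.
move=> M; apply: contrapT => hno.
(* [N'] is a multiple of both window lengths, and N = 2 N' keeps l + k i below N whenever l and k i
   are below [N']. *)
pose Q := M.+1; pose N' := (Q * J * J0)%N; pose N := (2 * N')%N.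
have N'0 : (0 < N')%N by rewrite !muln_gt0 Jp J0p.
have NM : (M <= N.-1)%N.
  rewrite /N /N' /Q; have : (1 * 1 <= J * J0)%N by exact: leq_mul.
  by nia.
have N0 : (0 < N)%N by rewrite /N; lia.
have N1 : N.-1.+1 = N by rewrite prednK.
have NR : 0 < N%:R :> R by rewrite ltr0n.
pose a (l : nat) := f (x1 *+ l).
pose s := N%:R * e.
have s0 : 0 <= s by rewrite mulr_ge0 ?ltW // divr_gt0 ?exprn_gt0 // !mulr_gt0.
have hs z : cabs z = 1 -> cabs (\sum_(l < N) a l * z ^+ l) <= s.
  move=> z1; rewrite leNgt; apply/negP => lt; apply: hno; exists N.-1, z; split => //.
  rewrite /twisted_avg N1 cabsM cabsV cabs_nat mulrC ler_pdivlMr // mulrC.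
  apply: ltW; under eq_bigr do rewrite add0r mulrC.
  exact: lt.
have hkN i : (i < Q * J0)%N -> (k i < N')%N.
  move=> iQ; have [/andP[_ h] _] := hk i; apply: leq_trans h _.
  by rewrite /N' mulnAC leq_mul2r iQ orbT.
have hk0N i : (i < Q * J)%N -> (k0 i < N')%N.
  move=> iQ; have [/andP[_ h] _] := hk0 i; apply: leq_trans h _.
  by rewrite /N' leq_mul2r iQ orbT.
have kinj := @windows_inj J k (fun i => (hk i).1).
have k0inj := @windows_inj J0 k0 (fun i => (hk0 i).1).
have QJ0 : (0 < Q * J0)%N by rewrite muln_gt0.
have := @correlation_bound R a k N (Q * J0) (N' + N) s _ _ N0 _ s0 hs QJ0.
have hM1 : (0 < N' + N)%N by rewrite addn_gt0 N'0.
have hM2 i : (i < Q * J0)%N -> (k i + N <= N' + N)%N.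
  by move=> iQ; rewrite leq_add2r; exact/ltnW/hkN.
move=> /(_ hM1 hM2 (fun i j _ _ => @kinj i j)).
set LHS := complex.Re _; set RHS := _ * _.
have hR : RHS <= s / 2 * (N%:R * A ^+ 2 + (Q * J0)%:R).
  apply: ler_wpM2l; first by rewrite divr_ge0.
  rewrite lerD2r; apply: (@le_trans _ _ (\sum_(l < N) A ^+ 2)).
    by apply: ler_sum => l _; rewrite ler_pXn2r ?nnegrE ?cabs_ge0 ?(ltW A0) ?hA.
  by rewrite sumr_const card_ord mulr_natl.
have hsq : (Q * J)%:R * c ^+ 2 <= \sum_(l < N') cabs (a l) ^+ 2.
  pose g (i : 'I_(Q * J)) : 'I_N' := Ordinal (hk0N i (ltn_ord i)).
  have ginj : injective g by move=> i j [] /k0inj /val_inj.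
  apply: (@le_trans _ _ (\sum_(l in codom g) cabs (a l) ^+ 2)).
    rewrite -big_uniq; last exact/injectiveP.
    rewrite big_map big_enum /= mulr_natl -[in X in _ *+ X <= _](card_ord (Q * J)) -sumr_const.
    apply: ler_sum => i _; rewrite ler_pXn2r ?nnegrE ?cabs_ge0 ?(ltW c0) //.
    have [_ /(_ 0)] := hk0 i; rewrite add0r /a /=.
    have : cabs (f 0) <= cabs (f (x1 *+ k0 i)) + cabs (f (x1 *+ k0 i) - f 0).
      have := cabsD (f (x1 *+ k0 i)) (- (f (x1 *+ k0 i) - f 0)).
      by rewrite cabsN opprB subrKC.
    by rewrite /c; lra.
  rewrite big_mkcond /=; apply: ler_sum => l _.
  by case: ifP => // _; exact: sqr_ge0.
have hL : (Q * J0)%:R * ((Q * J)%:R * c ^+ 2 - N%:R * (eta * A)) <= LHS.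
  rewrite /LHS raddf_sum /= mulr_natl -[in X in _ *+ X](card_ord (Q * J0)) -sumr_const.
  apply: ler_sum => i _; rewrite raddf_sum /=.
  apply: (@le_trans _ _ (\sum_(l < N) ((if (l + k i < N)%N then cabs (a l) ^+ 2 else 0) - eta * A))).
    rewrite sumrB sumr_const card_ord -(mulr_natl (eta * A)) lerD2r.
    apply: le_trans hsq _.
    rewrite (big_ord_widen N (fun l => cabs (a l) ^+ 2)); last first.
      by rewrite /N mul2n -addnn leq_addr.
    rewrite big_mkcond /=; apply: ler_sum => l _.
    case: ifP => lN'; last by case: ifP => // _; exact: sqr_ge0.
    case: ifP => // /negP[].
    apply: (@leq_trans (N' + N')%N); last by rewrite /N mul2n -addnn.
    by rewrite -addSn leq_add // ltnW // hkN.
  apply: ler_sum => l _; case: ifP => _; last first.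
    by rewrite sub0r oppr_le0 mulr_ge0 ?ltW.
  have -> : a l * (a (l + k i)%N)^*%C =
     a l * (a l)^*%C - a l * (a l - a (l + k i)%N)^*%C by rewrite rmorphB /=; ring.
  rewrite mulcJ raddfB /= lerD2l lerN2.
  apply: le_trans (Re_le_cabs _) _; rewrite cabsM cabsJ mulrC.
  apply: ler_pM; rewrite ?cabs_ge0 //; last exact: hA.
  rewrite cabs_distC; have [_ /(_ (x1 *+ l))] := hk i.
  by rewrite /a mulrnDr => /ltW.
move=> /(le_trans hL)/le_trans/(_ hR); apply/negP; rewrite -ltNge.
have -> : (Q * J)%:R * c ^+ 2 - N%:R * (eta * A) = Q%:R * J%:R * c ^+ 2 / 2 :> R.
  rewrite /eta /N /N' !natrM; field.
  by rewrite !gt_eqF.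
rewrite /s /e /N /N' !natrM.
set q : R := Q%:R; have q0 : 0 < q by rewrite ltr0n.
set t : R := J%:R; have tp : 0 < t by exact: JR.
set t0 : R := J0%:R; have t0p : 0 < t0 by exact: J0R.
have -> : 2 * (q * t * t0) * (c ^+ 2 / (4 * t0 * D)) / 2 *
    (2 * (q * t * t0) * A ^+ 2 + q * t0) = q * t0 * (q * t * c ^+ 2 / 2) / 2.
  have -> : 2 * (q * t * t0) * A ^+ 2 + q * t0 = q * t0 * D.
    by rewrite /D -/t; ring.
  by field; rewrite !gt_eqF.
have p : 0 < q * t0 * (q * t * c ^+ 2 / 2).
  have c2 : 0 < c ^+ 2 by exact: exprn_gt0.
  exact: mulr_gt0 (mulr_gt0 q0 t0p)
    (divr_gt0 (mulr_gt0 (mulr_gt0 q0 tp) c2) (ltr0Sn _ 1)).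
by lra.
Qed.

(** Large averages of [f] alone could come from the trivial character. For g = f - f(. + x_n) they
    produce a limit [h] of averages of [f] with h(0) != h(x_n). Then h(0) != 0, as otherwise the
    eigenvalue equation makes [h] vanish at all x_m with m >= 0. *)
Lemma exists_separating f (n : nat) : ccontinuous f ->
  f 0 != f (x1 *+ n) ->
  exists2 chi : G -> R[i], is_character chi & chi (x1 *+ n) != 1.
Proof.
move=> cf fn; pose g x := f x - f (x + x1 *+ n).
have cg : ccontinuous g by apply: ccontinuousB => //; exact: ccontinuous_trans.
have g0 : g 0 != 0 by rewrite /g add0r subr_eq0.
have [e e0 /choice [r /choice [z hrz]]] := large_twisted_avg cg g0.
have [h [lam [ch lam1 hl hN]]] := twisted_avg_limit hcompact x1 cf
  (fun j => let: And3 _ p _ := hrz j in p) (fun j => let: And3 p _ _ := hrz j in p).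
have e3 : 0 < e / 3 by rewrite divr_gt0.
have [j _ [_ hj]] := hN _ 0%N e3.
have [_ _ he] := hrz j.
have avgB : twisted_avg x1 g (z j) (r j) 0 =
    twisted_avg x1 f (z j) (r j) 0 - twisted_avg x1 f (z j) (r j) (x1 *+ n).
  rewrite /twisted_avg -mulrBr -sumrB; congr (_ * _); apply: eq_bigr => l _.
  by rewrite -mulrBr /g !add0r [x1 *+ n + _]addrC.
have hne : h 0 != h (x1 *+ n).
  apply/eqP => eh; move: he; rewrite avgB.
  have -> : twisted_avg x1 f (z j) (r j) 0 - twisted_avg x1 f (z j) (r j) (x1 *+ n) =
    (twisted_avg x1 f (z j) (r j) 0 - h 0) - (twisted_avg x1 f (z j) (r j) (x1 *+ n) - h (x1 *+ n)).
    by rewrite eh; ring.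
  move=> /le_trans/(_ (cabsD _ _)); rewrite cabsN.
  by have := hj 0; have := hj (x1 *+ n); lra.
have l0 : lam != 0 by rewrite -cabs_eq0 lam1 oner_eq0.
have h0 : h 0 != 0.
  apply/eqP => h00; move/eqP: hne; apply; rewrite h00.
  have : forall m, h (x1 *+ m) = 0.
    elim=> [|m IH]; first by rewrite mulr0n.
    by apply: (mulfI l0); rewrite mulrSr hl IH mulr0.
  by move=> ->.
have [hchi _] := eigenfunction_char hdense ch lam1 hl h0.
exists (fun x => h x / h 0) => //.
apply: contra hne => /eqP en; apply/eqP.
by rewrite -[RHS](divfK h0) en mul1r.
Qed.

Lemma exists_urysohn (y : G) : hausdorff_space G -> y != 0 ->
  exists2 f : G -> R[i], ccontinuous f & f 0 != f y.
Proof.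
move=> hh y0.
have /normal_separatorP sep := compact_normal hh hcompact.
have cl1 (x : G) : closed [set x] by exact/accessible_closed_set1/hausdorff_accessible.
have dis : [set 0] `&` [set y] = set0 :> set G.
  by apply/seteqP; split => // t [/= -> /eqP]; rewrite eq_sym (negPf y0).
have /(@uniform_separatorP _ R) [f [cf _ f0 f1]] := sep R _ _ (cl1 0) (cl1 y) dis.
exists (fun x => (f x)%:C%C).
  apply/ccontinuousP => x e e0.
  have : \forall y \near x, `|f x - f y| < e.
    by have /cvgr_dist_lt := cf x; apply.
  by apply: filterS => t; rewrite -rmorphB cabs_real distrC.
have -> : f 0 = 0 by apply: f0; exists 0.
have -> : f y = 1 by apply: f1; exists y.
by rewrite rmorph0 rmorph1 eq_sym oner_eq0.
Qed.

(** A relation x_n = 0 makes the orbit finite, hence closed, hence all of G by density. *)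
Lemma orbit_infinite : hausdorff_space G -> ~ finite_set [set: G] ->
  forall n : nat, (0 < n)%N -> x1 *+ n != 0.
Proof.
move=> hh hinf n n0; apply/eqP => xn0; apply: hinf.
have fin : finite_set (range (fun m : int => x1 *~ m)).
  apply: (@sub_finite_set _ _ ((fun m => x1 *+ m) @` `I_n)); last first.
    by apply: finite_image; exact: finite_II.
  have red m : x1 *+ m = x1 *+ (m %% n)%N.
    by rewrite [in LHS](divn_eq m n) mulrnDr mulnC mulrnA xn0 mul0rn add0r.
  move=> _ [[m|m] _ <-]; first by exists (m %% n)%N => /=; rewrite ?ltn_mod // -red.
  exists ((n * m.+1 - m.+1) %% n)%N => /=; first by rewrite ltn_mod.
  by rewrite -red mulrnBr ?leq_pmull // mulrnA xn0 mul0rn sub0r NegzE mulrNz.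
have cl := accessible_finite_set_closed.1 (hausdorff_accessible hh) _ fin.
by move: hdense; rewrite -(closure_id _).1 // => <-.
Qed.

Lemma char_orbit (chi : G -> R[i]) : is_character chi ->
  [/\ chi 0 = 1, (forall x, chi x != 0) & forall x, chi (- x) = (chi x)^-1].
Proof.
case=> _ cM c1.
have n0 x : chi x != 0 by rewrite -normr_eq0 c1 oner_eq0.
have e0 : chi 0 = 1 by apply: (mulfI (n0 0)); rewrite -cM addr0 mulr1.
split => // x; apply: (mulfI (n0 x)); rewrite -cM subrr e0 mulfV //.
Qed.

Lemma exists_char (n : int) : hausdorff_space G -> ~ finite_set [set: G] ->
  n != 0 -> exists2 chi : G -> R[i], is_character chi & chi (x1 *~ n) != 1.
Proof.
move=> hh hinf n0.
have hnat (m : nat) : (0 < m)%N ->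
    exists2 chi : G -> R[i], is_character chi & chi (x1 *+ m) != 1.
  move=> m0; have [f cf f0] := exists_urysohn hh (orbit_infinite hh hinf m0).
  exact: exists_separating cf f0.
case: n n0 => [m|m] m0; first by apply: hnat; lia.
have [chi hc h] := hnat m.+1 isT; exists chi => //.
have [_ _ cN] := char_orbit hc.
by rewrite NegzE mulrNz cN invr_eq1.
Qed.

End Characters.

(** * Polynomials in V with continuous coefficients, and the algebra B *)

Section Polynomials.
Variables (R : realType) (G : topologicalZmodType).
Hypothesis hcompact : compact [set: G].
Variable x1 : G.
Hypothesis hdense : closure (range (fun n : int => x1 *~ n)) = [set: G].
Local Notation poly := (seq (int * (G -> R[i]))).
Implicit Types (f g : G -> R[i]) (p q : int * (G -> R[i])) (P Q : poly).
Implicit Types S T : op R.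

(* [(k, f)] stands for the operator V^k M_f, a list for the sum. *)
Definition mono p : op R := wshift p.1 (fun l => p.2 (x1 *~ l)).

Definition ev P : op R := fun x l => \sum_(p <- P) mono p x l.

(** The translate comes from M_f V^m = V^m M_g with g = f(. + x_m). *)
Definition mulmono p q : int * (G -> R[i]) :=
  (p.1 + q.1, fun x => p.2 (x + x1 *~ q.1) * q.2 x).

Lemma VopE : @Vop R = mono (1, fun=> 1).
Proof. by apply/funext => x; apply/funext => l; rewrite /mono /wshift mul1r. Qed.

Lemma VinvE : @Vinv R = mono (-1, fun=> 1).
Proof. by apply/funext => x; apply/funext => l; rewrite /mono /wshift mul1r opprK. Qed.

Lemma MopE f : Mop x1 f = mono (0, f).
Proof. by apply/funext => x; apply/funext => l; rewrite /mono /wshift subr0. Qed.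

Lemma mono_comp p q : opcomp (mono p) (mono q) = mono (mulmono p q).
Proof.
apply/funext => x; apply/funext => l; rewrite /opcomp /mono /wshift /= mulrA opprD addrA.
by rewrite -mulrzDr subrK.
Qed.

Lemma ev_nil : ev [::] = @opzero R.
Proof. by apply/funext => x; apply/funext => l; rewrite /ev big_nil. Qed.

Lemma ev_cons p P : ev (p :: P) = opadd (mono p) (ev P).
Proof. by apply/funext => x; apply/funext => l; rewrite /ev big_cons. Qed.

Lemma ev_seq1 p : ev [:: p] = mono p.
Proof. by apply/funext => x; apply/funext => l; rewrite /ev big_seq1. Qed.

Lemma ev_cat P Q : ev (P ++ Q) = opadd (ev P) (ev Q).
Proof. by apply/funext => x; apply/funext => l; rewrite /ev big_cat. Qed.

Lemma ev_scale c P : ev [seq (p.1, fun x => c * p.2 x) | p <- P] = opscale c (ev P).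
Proof.
apply/funext => x; apply/funext => l; rewrite /ev big_map /opscale mulr_sumr.
by apply: eq_bigr => p _; rewrite /mono /wshift mulrA.
Qed.

Lemma ev_lin P x y (c : R[i]) :
  ev P (fun l => c * x l + y l) = (fun l => c * ev P x l + ev P y l).
Proof.
apply/funext => l; rewrite /ev mulr_sumr -big_split /=.
by apply: eq_bigr => p _; rewrite /mono /wshift; ring.
Qed.

Lemma ev_D P x y : ev P (fun l => x l + y l) = (fun l => ev P x l + ev P y l).
Proof.
have := ev_lin P x y 1; under eq_fun do rewrite mul1r.
by move=> ->; apply/funext => l; rewrite mul1r.
Qed.

Lemma ev_0 P : ev P (fun=> 0) = (fun=> 0).
Proof. by apply/funext => l; apply: big1 => p _; rewrite /mono /wshift mulr0. Qed.

Lemma ev_B P x y : ev P (fun l => x l - y l) = (fun l => ev P x l - ev P y l).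
Proof.
have := ev_lin P y x (-1); under eq_fun do rewrite mulN1r addrC.
by move=> ->; apply/funext => l; rewrite mulN1r addrC.
Qed.

Lemma ev_Z P x (c : R[i]) : ev P (fun l => c * x l) = (fun l => c * ev P x l).
Proof.
have := ev_lin P x (fun=> 0) c; under eq_fun do rewrite addr0.
by move=> ->; apply/funext => l; rewrite ev_0 addr0.
Qed.

Lemma mono_ev p P : opcomp (mono p) (ev P) = ev [seq mulmono p q | q <- P].
Proof.
apply/funext => x; apply/funext => l; rewrite /ev big_map.
rewrite /opcomp /mono /wshift mulr_sumr; apply: eq_bigr => q _.
by have := congr1 (fun T : op R => T x l) (mono_comp p q).
Qed.

Lemma ev_comp P Q : opcomp (ev P) (ev Q) = ev [seq mulmono p q | p <- P, q <- Q].
Proof.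
elim: P => [|p P IH]; first by rewrite ev_nil.
rewrite allpairs_cons ev_cat -IH -mono_ev ev_cons.
by [].
Qed.

(** Its values along the orbit fill the n-th diagonal of [ev P]; exponents may repeat in [P], hence
    the sum. *)
Definition dcoef P n : G -> R[i] := fun x => \sum_(p <- P | p.1 == n) p.2 x.

Lemma mono_entry p l n :
  mono p (ebasis R l) (l + n) = if p.1 == n then p.2 (x1 *~ l) else 0.
Proof.
rewrite /mono /wshift /ebasis.
have -> : (l + n - p.1 == l) = (p.1 == n) by apply/eqP/eqP; lia.
by case: eqP => [->|_]; rewrite ?mulr0 // addrK mulr1.
Qed.

Lemma ev_entry P l n : ev P (ebasis R l) (l + n) = dcoef P n (x1 *~ l).
Proof.
rewrite /ev /dcoef [in RHS]big_mkcond /=.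
by apply: eq_bigr => p _; rewrite mono_entry.
Qed.

Definition cpoly P := forall p, p \in P -> ccontinuous p.2.

Lemma cpoly_cons p P : cpoly (p :: P) <-> ccontinuous p.2 /\ cpoly P.
Proof.
split=> [h|[h1 h2] q]; last by rewrite inE => /orP [/eqP ->|/h2].
by split=> [|q qP]; apply: h; rewrite inE ?eqxx // qP orbT.
Qed.

Lemma cpoly_cat P Q : cpoly P -> cpoly Q -> cpoly (P ++ Q).
Proof. by move=> h1 h2 p; rewrite mem_cat => /orP [/h1|/h2]. Qed.

Lemma cpoly_scale c P : cpoly P -> cpoly [seq (p.1, fun x => c * p.2 x) | p <- P].
Proof. by move=> h _ /mapP [p pP ->]; apply: ccontinuousZ; exact: h. Qed.

Lemma cpoly_mul P Q : cpoly P -> cpoly Q ->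
  cpoly [seq mulmono p q | p <- P, q <- Q].
Proof.
move=> h1 h2 _ /allpairsP [[p q] /= [pP qQ ->]]; apply: ccontinuousM.
  exact: ccontinuous_trans (h1 _ pP).
exact: h2.
Qed.

Lemma ccontinuous_dcoef P n : cpoly P -> ccontinuous (dcoef P n).
Proof.
elim: P => [_|p P IH /cpoly_cons [hp /IH hP]].
  rewrite (_ : dcoef _ _ = fun=> 0); first exact: ccontinuous_cst.
  by apply/funext => x; rewrite /dcoef big_nil.
have := ccontinuousD (ccontinuousZ (p.1 == n)%:R hp) hP.
congr ccontinuous; apply/funext => x; rewrite /dcoef big_cons.
by case: ifP => _; rewrite ?mul1r ?mul0r ?add0r.
Qed.

Lemma bounded_mono p : ccontinuous p.2 -> bounded_op (mono p).
Proof.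
move=> cp; have [C _ hC] := ccontinuous_bounded hcompact cp.
by apply: (@bounded_wshift _ _ _ C) => l.
Qed.

Lemma bounded_ev P : cpoly P -> bounded_op (ev P).
Proof.
elim: P => [_|p P IH /cpoly_cons [hp /IH hP]].
  rewrite ev_nil; split; last first.
    by exists 0 => x _; rewrite n2E esum1 ?expr0n ?mul0e // => l _; rewrite cabs0 expr0n.
  by move=> x y c _ _; apply/funext => l; rewrite /opzero mulr0 addr0.
by rewrite ev_cons; apply: bounded_add => //; exact: bounded_mono.
Qed.

Lemma Bset_bounded T : Bset x1 T -> bounded_op T. Proof. by case. Qed.

Lemma Bset_add S T : Bset x1 S -> Bset x1 T -> Bset x1 (opadd S T).
Proof.
move=> [bS hS] [bT hT]; split; first exact: bounded_add.
move=> X h1 h2 h3 h4 h5 h6 h7 h8.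
exact: h4 _ _ (hS X h1 h2 h3 h4 h5 h6 h7 h8)
  (hT X h1 h2 h3 h4 h5 h6 h7 h8).
Qed.

Lemma Bset_scale c T : Bset x1 T -> Bset x1 (opscale c T).
Proof.
move=> [bT hT]; split; first exact: bounded_scale.
by move=> X h1 h2 h3 h4 h5 h6 h7 h8; exact: h5 _ _ (hT X h1 h2 h3 h4 h5 h6 h7 h8).
Qed.

Lemma Bset_comp S T : Bset x1 S -> Bset x1 T -> Bset x1 (opcomp S T).
Proof.
move=> [bS hS] [bT hT]; split; first exact: bounded_comp.
move=> X h1 h2 h3 h4 h5 h6 h7 h8.
exact: h6 _ _ (hS X h1 h2 h3 h4 h5 h6 h7 h8)
  (hT X h1 h2 h3 h4 h5 h6 h7 h8).
Qed.

Lemma Bset_eq S T : opeq S T -> Bset x1 S -> Bset x1 T.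
Proof.
move=> e [bS hS]; split; first exact: bounded_eq bS.
move=> X h1 h2 h3 h4 h5 h6 h7 h8; exact: h7 _ _ e (hS X h1 h2 h3 h4 h5 h6 h7 h8).
Qed.

Lemma Bset_sub S T : Bset x1 S -> Bset x1 T -> Bset x1 (opsub S T).
Proof.
move=> hS hT; apply: (@Bset_eq (opadd S (opscale (-1) T))).
  by move=> x _; apply/funext => l; rewrite /opadd /opscale mulN1r.
by apply: Bset_add => //; exact: Bset_scale.
Qed.

Lemma Bset_V : Bset x1 (@Vop R).
Proof. by split=> //; rewrite VopE; apply: bounded_mono; exact: ccontinuous_cst. Qed.

Lemma Bset_Vinv : Bset x1 (@Vinv R).
Proof. by split=> //; rewrite VinvE; apply: bounded_mono; exact: ccontinuous_cst. Qed.

Lemma Bset_M f : ccontinuous f -> Bset x1 (Mop x1 f).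
Proof.
move=> cf; split; first by rewrite MopE; exact: bounded_mono.
by move=> X h1 h2 h3 *; exact: h3.
Qed.

Lemma wshift_split k f : mono (k, f) = opcomp (mono (k, fun=> 1)) (Mop x1 f).
Proof.
rewrite MopE mono_comp /mulmono /= addr0; congr (mono (_, _)).
by apply/funext => x; rewrite mul1r.
Qed.

Lemma shift_comp k m :
  opcomp (mono (k, fun=> 1)) (mono (m, fun=> 1)) = mono (k + m, fun=> 1).
Proof.
rewrite mono_comp /mulmono /=; congr (mono (_, _)).
by apply/funext => x; rewrite mul1r.
Qed.

Lemma Bset_shift k : Bset x1 (mono (k, fun=> 1)).
Proof.
case: k => n; elim: n => [|n IH].
- rewrite -(_ : Mop x1 (fun=> 1) = mono (0, fun=> 1)); last by rewrite MopE.
  by apply: Bset_M; exact: ccontinuous_cst.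
- have -> : Posz n.+1 = 1 + n%:Z by rewrite -addn1 PoszD addrC.
  by rewrite -shift_comp; apply: Bset_comp => //; rewrite -VopE; exact: Bset_V.
- by rewrite -VinvE; exact: Bset_Vinv.
have -> : Negz n.+1 = -1 + Negz n by lia.
by rewrite -shift_comp; apply: Bset_comp => //; rewrite -VinvE; exact: Bset_Vinv.
Qed.

Lemma Bset_mono p : ccontinuous p.2 -> Bset x1 (mono p).
Proof.
case: p => k f cf; rewrite wshift_split; apply: Bset_comp; first exact: Bset_shift.
exact: Bset_M.
Qed.

Lemma Bset_ev P : cpoly P -> Bset x1 (ev P).
Proof.
elim: P => [_|p P IH /cpoly_cons [hp /IH hP]].
  rewrite ev_nil; apply: (@Bset_eq (opscale 0 (@Vop R))).
    by move=> x _; apply/funext => l; rewrite /opscale mul0r.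
  by apply: Bset_scale; exact: Bset_V.
by rewrite ev_cons; apply: Bset_add => //; exact: Bset_mono.
Qed.

(** The norm closure of the polynomials: the class against which the minimality clause of [Bset] is
    tested. *)
Definition approximable (T : op R) := bounded_op T /\ forall e : R, 0 < e ->
  exists2 P, cpoly P & opnorm_le (opsub T (ev P)) e.

Lemma opnorm_subrr (T : op R) (e : R) : opnorm_le (opsub T T) e.
Proof.
move=> x _; rewrite n2E esum1; first by rewrite mule_ge0 ?lee_fin ?sqr_ge0 ?n2_ge0.
by move=> l _; rewrite /opsub subrr cabs0 expr0n.
Qed.

Lemma approximable_ev P : cpoly P -> approximable (ev P).
Proof.
by move=> hP; split=> [|e e0]; [exact: bounded_ev|exists P => //; exact: opnorm_subrr].
Qed.

Lemma approximable_mono p : ccontinuous p.2 -> approximable (mono p).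
Proof.
move=> hp; rewrite -ev_seq1; apply: approximable_ev.
by apply/cpoly_cons; split.
Qed.

Lemma opnorm_sub_trans (S T U : op R) (a b : R) : 0 < a -> 0 < b ->
  opnorm_le (opsub S T) a -> opnorm_le (opsub T U) b -> opnorm_le (opsub S U) (a + b).
Proof.
move=> a0 b0 h1 h2; have := opnorm_leD a0 b0 h1 h2; apply: opeq_opnorm => x _.
by apply/funext => l; rewrite /opadd /opsub addrA subrK.
Qed.

Lemma approximable_add S T : approximable S -> approximable T -> approximable (opadd S T).
Proof.
move=> [bS hS] [bT hT]; split; first exact: bounded_add.
move=> e e0; have e2 : 0 < e / 2 by rewrite divr_gt0.
have [P hP h1] := hS _ e2; have [Q hQ h2] := hT _ e2.
exists (P ++ Q); first exact: cpoly_cat.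
rewrite (splitr e) ev_cat; have := opnorm_leD e2 e2 h1 h2.
apply: opeq_opnorm => x _; apply/funext => l; rewrite /opadd /opsub; ring.
Qed.

Lemma approximable_scale c T : approximable T -> approximable (opscale c T).
Proof.
move=> [bT hT]; split; first exact: bounded_scale.
move=> e e0; have c1 : 0 < cabs c + 1 by rewrite ltr_wpDl ?cabs_ge0.
have e2 : 0 < e / (cabs c + 1) by rewrite divr_gt0.
have [P hP h1] := hT _ e2.
exists [seq (p.1, fun x => c * p.2 x) | p <- P]; first exact: cpoly_scale.
rewrite ev_scale.
have := opnorm_leZ c h1 => h.
apply: (@opnorm_leW _ _ (cabs c * (e / (cabs c + 1)))).
- by rewrite mulr_ge0 ?cabs_ge0 // ltW.
- by rewrite mulrA ler_pdivrMr // mulrC ler_wpM2l ?(ltW e0) // lerDl.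
by apply: opeq_opnorm h => x _; apply/funext => l; rewrite /opscale /opsub mulrBr.
Qed.

Lemma approximable_comp S T : approximable S -> approximable T -> approximable (opcomp S T).
Proof.
move=> [bS hS] [bT hT]; split; first exact: bounded_comp.
move=> e e0; have e2 : 0 < e / 2 by rewrite divr_gt0.
(* With polynomials P and Q for S and T, S T - P Q = S (T - Q) + (S - P) Q. The bound of [S] governs
   the choice of [Q], and only then does the bound of [Q] govern that of [P]. *)
have [a a0 ha] := bounded_norm bS.
have ea : 0 < e / 2 / a by rewrite divr_gt0.
have [Q hQ h1] := hT _ ea.
have [b b0 hb] := bounded_norm (bounded_ev hQ).
have eb : 0 < e / 2 / b by rewrite divr_gt0.
have [P hP h2] := hS _ eb.
exists [seq mulmono p q | p <- P, q <- Q]; first exact: cpoly_mul.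
rewrite -ev_comp (splitr e); apply: (@opnorm_sub_trans _ (opcomp S (ev Q))) => //.
  have := opnorm_le_comp ha h1; rewrite mulrC divfK ?gt_eqF //.
  apply: opeq_opnorm => x hx; apply/funext => l; rewrite /opcomp /opsub.
  have lT : l2 (T x) by exact: bounded_l2.
  have lQ : l2 (ev Q x) by apply: bounded_l2 => //; exact: bounded_ev.
  have := bounded_lin (-1) bS lQ lT.
  under [X in S X = _]eq_fun do rewrite mulN1r addrC.
  by move=> ->; rewrite mulN1r addrC.
by have := opnorm_le_comp h2 hb; rewrite divfK ?gt_eqF.
Qed.

Lemma Bset_approx T : Bset x1 T -> approximable T.
Proof.
case=> _; apply.
- by rewrite VopE; apply: approximable_mono; exact: ccontinuous_cst.
- by rewrite VinvE; apply: approximable_mono; exact: ccontinuous_cst.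
- by move=> f cf; rewrite MopE; exact: approximable_mono.
- exact: approximable_add.
- exact: approximable_scale.
- exact: approximable_comp.
- move=> U W eUW [bU hU]; split; first exact: bounded_eq bU.
  move=> e e0; have [P hP h] := hU e e0; exists P => //.
  by apply: opeq_opnorm h => x hx; rewrite /opsub eUW.
move=> u U hu bU hl; split => // e e0; have e2 : 0 < e / 2 by rewrite divr_gt0.
have [n hn] := filter_ex (hl _ e2).
have [_ /(_ _ e2) [P hP h]] := hu n; exists P => //.
by rewrite (splitr e); apply: opnorm_sub_trans h => //; exact: opnorm_le_subC.
Qed.

(** The n-th diagonals of approximating polynomials come from continuous functions. Norm closeness
    makes these uniformly Cauchy on the orbit, hence on G by density, and a uniform limit is
    continuous. *)
Lemma Bset_coef T n : Bset x1 T -> exists f, ccontinuous f /\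
  forall l : int, f (x1 *~ l) = T (ebasis R l) (l + n).
Proof.
move=> /Bset_approx [bT hT].
have j0 (j : nat) : 0 < j.+1%:R^-1 :> R by rewrite invr_gt0.
have /choice [P /all_and2 [hP hj]] : forall j : nat, exists P, cpoly P /\
    opnorm_le (opsub T (ev P)) j.+1%:R^-1.
  by move=> j; have [P ? ?] := hT _ (j0 j); exists P.
pose g j := dcoef (P j) n.
have cg j : ccontinuous (g j) by exact: ccontinuous_dcoef.
have hg j l : cabs (T (ebasis R l) (l + n) - g j (x1 *~ l)) <= j.+1%:R^-1.
  have := @opnorm_entry _ _ _ l (l + n) (ltW (j0 j)) (hj j).
  by rewrite /opsub ev_entry.
have inv_le i j : (i <= j)%N -> j.+1%:R^-1 <= i.+1%:R^-1 :> R.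
  by move=> ij; rewrite lef_pV2 ?posrE ?ltr0n // ler_nat.
have gij i j x : (i <= j)%N -> cabs (g j x - g i x) <= 2 / i.+1%:R.
  move=> ij; apply: (@cabs_le_orbit _ _ x1 hdense (fun x => g j x - g i x)).
    exact: ccontinuousB.
  move=> l; apply: le_trans (cabs_dist_add _ _ (T (ebasis R l) (l + n))) _.
  move: (hg i l) (hg j l) (inv_le _ _ ij); rewrite (cabs_distC (g j _)).
  by move: (i.+1%:R^-1) (j.+1%:R^-1) => u v; lra.
have [U [UF ooU]] := exists_ultra_nat.
have /choice [f hf] : forall x, exists c : R[i], forall e : R, 0 < e ->
    U [set j | cabs (g j x - c) < e].
  have [C C0 hC] := ccontinuous_bounded hcompact (cg 0%N).
  move=> x; apply: (@ultra_lim _ _ _ _ (C + 2)) => j.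
  rewrite -[g j x](subrKC (g 0%N x)); apply: le_trans (cabsD _ _) _.
  by apply: lerD => //; have := gij 0%N j x (leq0n j); rewrite divr1.
have gf i x : cabs (f x - g i x) <= 2 / i.+1%:R.
  apply/ler_addgt0Pr => e e0.
  have hM : U [set N | (i <= N)%N] by apply: ooU; exact: nbhs_infty_ge.
  have [j [/= h1 h2]] := filter_ex (filterI (hf x e e0) hM).
  apply: le_trans (cabs_dist_add _ _ (g j x)) _; rewrite addrC.
  by apply: lerD; [exact: gij | rewrite cabs_distC ltW].
have small (e : R) : 0 < e -> exists i : nat, 2 / i.+1%:R <= e.
  move=> e0; exists (Num.truncn (2 / e)); rewrite ler_pdivrMr ?ltr0n // -ler_pdivrMl //.
  by rewrite mulrC; apply: ltW; exact: truncnS_gt.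
exists f; split.
  apply/ccontinuousP => x e e0; have e4 : 0 < e / 4 by rewrite divr_gt0.
  have [i hi] := small _ e4.
  have /ccontinuousP cgi := cg i; apply: filterS (cgi x _ e4) => y hy.
  have h1 := le_trans (gf i x) hi; have h2 := le_trans (gf i y) hi.
  apply: le_lt_trans (cabs_dist_add _ _ (g i y)) _.
  apply: le_lt_trans (lerD (lexx _) (cabs_dist_add _ _ (g i x))) _.
  by rewrite (cabs_distC _ (f x)); lra.
move=> l; apply/eqP; rewrite -subr_eq0 -cabs_eq0 eq_le cabs_ge0 andbT.
apply/ler_addgt0Pr => e e0; rewrite add0r; have e2 : 0 < e / 2 by rewrite divr_gt0.
have [i hi] := small _ e2.
apply: le_trans (cabs_dist_add _ _ (g i (x1 *~ l))) _.
move: (gf i (x1 *~ l)) (hg i l) (j0 i) hi; rewrite (cabs_distC (g i _)).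
by move: (i.+1%:R^-1) => u; lra.
Qed.

Lemma fejer_wshift N k a : fejer N (wshift k a) = opscale
  (N%:R^-1 * (\sum_(j < N) \sum_(i < N) (j%:Z - i%:Z == k)%R)%N%:R) (@wshift R k a).
Proof.
apply/funext => x; apply/funext => l; rewrite /fejer /opscale -mulrA; congr (_ * _).
rewrite natr_sum mulr_suml; apply: eq_bigr => j _.
rewrite natr_sum mulr_suml; apply: eq_bigr => i _; rewrite /wshift /ebasis.
have -> : (l - k == l - j%:Z + i%:Z) = (j%:Z - i%:Z == k) by apply/eqP/eqP; lia.
case: eqP => [<-|_]; last by rewrite mulr0 !mul0r.
by rewrite mulr1 mul1r; congr (_ * x _); lia.
Qed.

Lemma fejer_cvg_mono p : ccontinuous p.2 -> opcvg (fun N => fejer N (mono p)) (mono p).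
Proof.
move=> cp e e0; have [a a0 ha] := bounded_norm (bounded_mono cp).
(* The weight of diagonal k differs from 1 by at most |k|/N, so the error is at most |k| a / N,
   which is below e once N > M. *)
pose M := Num.truncn (`|p.1|%N%:R * a / e).
near=> N.
have NM : (M < N)%N by near: N; exact: nbhs_infty_gt.
have N0 : (0 < N)%N by exact: leq_ltn_trans NM.
have NR : 0 < N%:R :> R by rewrite ltr0n.
rewrite {1}/mono fejer_wshift -/(mono p); set c := (\sum_(j < N) _)%N.
have /andP[c1 c2] : (c <= N <= c + `|p.1|)%N by exact: count_diff.
pose t : R[i] := N%:R^-1 * c%:R - 1.
have -> : opsub (opscale (N%:R^-1 * c%:R) (mono p)) (mono p) = opscale t (mono p).
  by apply/funext => x; apply/funext => l; rewrite /opsub /opscale /t mulrBl mul1r.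
have ht : cabs t <= `|p.1|%N%:R / N%:R.
  have -> : t = - ((N%:R^-1 * (N - c)%N%:R : R)%:C)%C.
    rewrite rmorphM fmorphV !rmorph_nat natrB // mulrBr mulVf ?pnatr_eq0 -?lt0n //.
    by rewrite /t opprB.
  rewrite cabsN cabs_real ger0_norm ?mulr_ge0 ?invr_ge0 // mulrC.
  by rewrite ler_pM2r ?invr_gt0 // ler_nat leq_subLR.
apply: (@opnorm_leW _ _ (cabs t * a)); last exact: opnorm_leZ.
  by rewrite mulr_ge0 ?cabs_ge0 // ltW.
apply: (@le_trans _ _ (`|p.1|%N%:R / N%:R * a)); first by rewrite ler_wpM2r // ltW.
rewrite mulrAC ler_pdivrMr // -ler_pdivrMl // mulrC; apply: ltW.
apply: lt_le_trans (truncnS_gt _) _; by rewrite ler_nat.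
Unshelve. all: end_near. Qed.

Lemma fejer_cvg_ev P : cpoly P -> opcvg (fun N => fejer N (ev P)) (ev P).
Proof.
elim: P => [_ e e0|p P IH /cpoly_cons [hp /IH hP] e e0].
  apply: filterS filterT => N _; rewrite ev_nil.
  have -> : fejer N (@opzero R) = @opzero R; last exact: opnorm_subrr.
  apply/funext => x; apply/funext => l; rewrite /fejer big1 ?mulr0 // => j _.
  by rewrite big1 // => i _; rewrite mul0r.
have e2 : 0 < e / 2 by rewrite divr_gt0.
apply: filterS2 (fejer_cvg_mono hp e2) (hP _ e2) => N h1 h2.
rewrite ev_cons fejer_add (splitr e).
have := opnorm_leD e2 e2 h1 h2; apply: opeq_opnorm => x _; apply/funext => l.
by rewrite /opadd /opsub; ring.
Qed.

(** Convergence on polynomials passes to their norm closure because [fejer_contraction] is uniform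
    in N. *)
Lemma fejer_cvg T : Bset x1 T -> opcvg (fun N => fejer N T) T.
Proof.
move=> /Bset_approx [bT hT] e e0; have e3 : 0 < e / 3 by rewrite divr_gt0.
have [P hP h] := hT _ e3.
apply: filterS (fejer_cvg_ev hP e3) => N h2.
have bTP : bounded_op (opsub T (ev P)) by apply: bounded_sub => //; exact: bounded_ev.
have h3 := fejer_contraction N bTP h; rewrite fejer_sub in h3.
have -> : e = e / 3 + (e / 3 + e / 3) by lra.
apply: opnorm_sub_trans h3 _; rewrite ?addr_gt0 //.
by apply: opnorm_sub_trans h2 _ => //; exact: opnorm_le_subC.
Qed.

End Polynomials.

(** * The algebra calB, its derivations, and the derivation attached to partial *)

Section Generators.
Variables (R : realType) (G : topologicalZmodType).
Hypothesis hcompact : compact [set: G].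
Variable x1 : G.
Hypothesis hdense : closure (range (fun n : int => x1 *~ n)) = [set: G].
Implicit Types (f g chi : G -> R[i]) (P Q : seq (int * (G -> R[i]))) (a b S T : op R).

Lemma character_cst1 : is_character (fun _ : G => 1 : R[i]).
Proof.
split=> *; rewrite ?mulr1 ?normr1 //; exact: ccontinuous_cst.
Qed.

Lemma character_mul chi psi : is_character chi -> is_character psi ->
  is_character (fun x => chi x * psi x).
Proof.
move=> [c1 m1 n1] [c2 m2 n2]; split.
- exact: ccontinuousM.
- by move=> x y; rewrite m1 m2 mulrACA.
- by move=> x; rewrite normrM n1 n2 mulr1.
Qed.

Lemma in_F_char chi : is_character chi -> in_F chi.
Proof.
move=> h; exists [:: (1, chi)]; split; first by move=> p; rewrite inE => /eqP ->.
by apply/funext => x; rewrite big_seq1 mul1r.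
Qed.

Lemma in_F_cst1 : in_F (fun _ : G => 1 : R[i]).
Proof. exact/in_F_char/character_cst1. Qed.

Lemma in_F_lin (c : R[i]) f g : in_F f -> in_F g -> in_F (fun x => c * f x + g x).
Proof.
move=> [s [hs ->]] [t [ht ->]].
exists ([seq (c * p.1, p.2) | p <- s] ++ t); split.
  by move=> p; rewrite mem_cat => /orP [/mapP [q qs ->]|/ht] //=; exact: hs.
apply/funext => x; rewrite big_cat big_map /= mulr_sumr; congr (_ + _).
by apply: eq_bigr => p _; rewrite mulrA.
Qed.

Lemma in_F_0 : in_F (fun _ : G => 0 : R[i]).
Proof. by exists [::]; split => //; apply/funext => x; rewrite big_nil. Qed.

Lemma in_F_Z (c : R[i]) f : in_F f -> in_F (fun x => c * f x).
Proof.
move=> hf; have := in_F_lin c hf in_F_0; congr in_F.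
by apply/funext => x; rewrite addr0.
Qed.

Lemma in_F_mul f g : in_F f -> in_F g -> in_F (fun x => f x * g x).
Proof.
move=> [s [hs ->]] [t [ht ->]].
exists [seq (p.1 * q.1, fun x => p.2 x * q.2 x) | p <- s, q <- t]; split.
  move=> _ /allpairsP [[p q] /= [ps qt ->]] /=.
  by apply: character_mul; [exact: hs|exact: ht].
apply/funext => x; rewrite big_allpairs_dep big_distrl /=; apply: eq_bigr => p _.
by rewrite mulr_sumr; apply: eq_bigr => q _; rewrite mulrACA.
Qed.

Lemma in_F_trans (y : G) f : in_F f -> in_F (fun x => f (x + y)).
Proof.
move=> [s [hs ->]]; exists [seq (p.1 * p.2 y, p.2) | p <- s]; split.
  by move=> _ /mapP [q qs ->] /=; exact: hs.
apply/funext => x; rewrite big_map big_seq [in RHS]big_seq; apply: eq_bigr => p ps.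
have [_ cM _] := hs _ ps.
by rewrite cM mulrAC mulrA.
Qed.

Lemma in_F_sum (I : eqType) (s : seq I) (F : I -> G -> R[i]) :
  (forall i, i \in s -> in_F (F i)) -> in_F (fun x => \sum_(i <- s) F i x).
Proof.
elim: s => [_|i s IH h].
  by have := in_F_0; congr in_F; apply/funext => x; rewrite big_nil.
have := @in_F_lin 1 _ _ (h i _) (IH _); rewrite mem_head => /(_ isT).
have hs j : j \in s -> in_F (F j) by move=> js; apply: h; rewrite inE js orbT.
move=> /(_ hs); congr in_F; apply/funext => x; by rewrite big_cons mul1r.
Qed.

Lemma in_F_cont f : in_F f -> ccontinuous f.
Proof.
move=> [s [hs ->]]; elim: s hs => [_|p s IH hs].
  by have := @ccontinuous_cst R G 0; congr ccontinuous; apply/funext => x; rewrite big_nil.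
have [cp _ _] := hs p (mem_head _ _).
have := ccontinuousD (ccontinuousZ p.1 cp) (IH _).
have hs' q : q \in s -> is_character q.2 by move=> qs; apply: hs; rewrite inE qs orbT.
by move=> /(_ hs'); congr ccontinuous; apply/funext => x; rewrite big_cons.
Qed.

Definition Fpoly P := forall p, p \in P -> in_F p.2.

Lemma Fpoly_cpoly P : Fpoly P -> cpoly P.
Proof. by move=> h p /h /in_F_cont. Qed.

Lemma Fpoly_cat P Q : Fpoly P -> Fpoly Q -> Fpoly (P ++ Q).
Proof. by move=> h1 h2 p; rewrite mem_cat => /orP [/h1|/h2]. Qed.

Lemma Fpoly_scale c P : Fpoly P -> Fpoly [seq (p.1, fun x => c * p.2 x) | p <- P].
Proof. by move=> h _ /mapP [p pP ->]; apply: in_F_Z; exact: h. Qed.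

Lemma Fpoly_mul P Q : Fpoly P -> Fpoly Q ->
  Fpoly [seq mulmono x1 p q | p <- P, q <- Q].
Proof.
move=> h1 h2 _ /allpairsP [[p q] /= [pP qQ ->]]; apply: in_F_mul; last exact: h2.
exact: in_F_trans (h1 _ pP).
Qed.

Lemma Fpoly1 (k : int) f : in_F f -> Fpoly [:: (k, f)].
Proof. by move=> h p; rewrite inE => /eqP ->. Qed.

(** Equality holds on all coordinate sequences, not just on l^2, so a relation such as M_f M_g = M_g
    M_f can be rewritten inside the argument of a derivation. *)
Lemma calB_ev a : calB x1 a -> exists2 P, Fpoly P & a = ev x1 P.
Proof.
elim=> [|| chi hc | S T _ [P hP ->] _ [Q hQ ->] | c S _ [P hP ->]
       | S T _ [P hP ->] _ [Q hQ ->]].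
- by exists [:: (1, fun=> 1)]; [exact: Fpoly1 in_F_cst1 | rewrite ev_seq1 -VopE].
- by exists [:: (-1, fun=> 1)]; [exact: Fpoly1 in_F_cst1 | rewrite ev_seq1 -VinvE].
- by exists [:: (0, chi)]; [exact/Fpoly1/in_F_char | rewrite ev_seq1 -MopE].
- by exists (P ++ Q); [exact: Fpoly_cat | rewrite ev_cat].
- by exists [seq (p.1, fun x => c * p.2 x) | p <- P];
    [exact: Fpoly_scale | rewrite ev_scale].
by exists [seq mulmono x1 p q | p <- P, q <- Q]; [exact: Fpoly_mul | rewrite ev_comp].
Qed.

Lemma calB_zero : calB x1 (@opzero R).
Proof.
have -> : @opzero R = opscale 0 (@Vop R).
  by apply/funext => x; apply/funext => l; rewrite /opscale mul0r.
exact/calB_scale/calB_V.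
Qed.

Lemma calB_M_F f : in_F f -> calB x1 (Mop x1 f).
Proof.
move=> [s [hs ->]]; elim: s hs => [_|p s IH hs].
  have := calB_zero; congr calB; apply/funext => x; apply/funext => l.
  by rewrite /Mop big_nil mul0r.
have hs' q : q \in s -> is_character q.2 by move=> qs; apply: hs; rewrite inE qs orbT.
have := calB_add (calB_scale p.1 (calB_M x1 (hs p (mem_head _ _)))) (IH hs').
congr calB; apply/funext => x; apply/funext => l.
by rewrite /opadd /opscale /Mop big_cons mulrDl mulrA.
Qed.

Lemma calB_Bset a : calB x1 a -> Bset x1 a.
Proof.
by move=> /calB_ev [P hP ->]; apply: Bset_ev => //; exact: Fpoly_cpoly.
Qed.

Lemma calB_bounded a : calB x1 a -> bounded_op a.
Proof. by move=> /calB_Bset; exact: Bset_bounded. Qed.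

Lemma calB_l2 a x : calB x1 a -> l2 x -> l2 (a x).
Proof. by move=> /calB_bounded; exact: bounded_l2. Qed.

Lemma calB_id : calB x1 (fun x : int -> R[i] => x).
Proof.
have -> : (fun x : int -> R[i] => x) = opcomp (@Vop R) (@Vinv R).
  by apply/funext => x; apply/funext => l; rewrite /opcomp /Vop /Vinv subrK.
by apply: calB_comp; [exact: calB_V|exact: calB_Vinv].
Qed.

Lemma VinvK (x : int -> R[i]) : Vop (Vinv x) = x.
Proof. by apply/funext => l; rewrite /Vop /Vinv subrK. Qed.

Lemma VopK (x : int -> R[i]) : Vinv (Vop x) = x.
Proof. by apply/funext => l; rewrite /Vop /Vinv addrK. Qed.

Section Derivation.
Variable D : op R -> op R.
Hypothesis hD : is_derivation x1 D.

Lemma derivation_Bset b : calB x1 b -> Bset x1 (D b). Proof. by case: hD => h _ _; exact: h. Qed.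

Lemma derivation_bounded b : calB x1 b -> bounded_op (D b).
Proof. by move=> /derivation_Bset; exact: Bset_bounded. Qed.

Lemma derivation_lin a b c x : calB x1 a -> calB x1 b -> l2 x ->
  D (opadd (opscale c a) b) x = (fun l => c * D a x l + D b x l).
Proof. by move=> ha hb hx; case: hD => _ h _; exact: (h a b c). Qed.

Lemma derivation_comp a b x : calB x1 a -> calB x1 b -> l2 x ->
  D (opcomp a b) x = (fun l => D a (b x) l + a (D b x) l).
Proof. by move=> ha hb hx; case: hD => _ _ h; exact: (h a b). Qed.

Lemma derivation_zero x : l2 x -> D (@opzero R) x = (fun=> 0).
Proof.
move=> hx; have := derivation_lin 1 calB_zero calB_zero hx.
have -> : opadd (opscale 1 (@opzero R)) (@opzero R) = @opzero R.
  by apply/funext => y; apply/funext => l; rewrite /opadd /opscale /opzero mulr0 addr0.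
move=> h; apply/funext => l; have := congr1 (@^~ l) h.
by rewrite mul1r => /esym/(canRL (addrK _)); rewrite subrr.
Qed.

Lemma derivation_scale a c x : calB x1 a -> l2 x ->
  D (opscale c a) x = (fun l => c * D a x l).
Proof.
move=> ha hx; have := derivation_lin c ha calB_zero hx; rewrite derivation_zero //.
have -> : opadd (opscale c a) (@opzero R) = opscale c a.
  by apply/funext => y; apply/funext => l; rewrite /opadd addr0.
by move=> ->; apply/funext => l; rewrite addr0.
Qed.

Lemma derivation_add a b x : calB x1 a -> calB x1 b -> l2 x ->
  D (opadd a b) x = (fun l => D a x l + D b x l).
Proof.
move=> ha hb hx; have := derivation_lin 1 ha hb hx.
have -> : opscale 1 a = a.
  by apply/funext => y; apply/funext => l; rewrite /opscale mul1r.
by move=> ->; apply/funext => l; rewrite mul1r.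
Qed.

Lemma derivation_id x : l2 x -> D (fun x => x) x = (fun=> 0).
Proof.
move=> hx; have := derivation_comp calB_id calB_id hx => h.
apply/funext => l; have := congr1 (@^~ l) h.
by rewrite -[opcomp _ _]/(fun x : int -> R[i] => x) => /esym/(canRL (addrK _)); rewrite subrr.
Qed.

Lemma derivation_Vinv x : l2 x -> D (@Vinv R) x = (fun l => - Vinv (D (@Vop R) (Vinv x)) l).
Proof.
move=> hx; have hy : l2 (Vinv x) by apply: calB_l2 => //; exact: calB_Vinv.
have := derivation_comp (calB_Vinv R x1) (calB_V R x1) hy.
have -> : opcomp (@Vinv R) (@Vop R) = fun x => x by apply/funext => y; exact: VopK.
rewrite derivation_id // VinvK => h; apply/funext => l.
by apply/eqP; rewrite -addr_eq0; apply/eqP/esym; have := congr1 (@^~ l) h.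
Qed.

End Derivation.

(** The value at V^-1 is forced, D(V^-1) = -V^-1 D(V) V^-1, so V and the characters suffice. *)
Lemma derivation_ext D D' : is_derivation x1 D -> is_derivation x1 D' ->
  opeq (D (@Vop R)) (D' (@Vop R)) ->
  (forall chi, is_character chi -> opeq (D (Mop x1 chi)) (D' (Mop x1 chi))) ->
  forall b, calB x1 b -> opeq (D b) (D' b).
Proof.
move=> hD hD' hV hM b; elim=> [|| chi hc | S T hS IS hT IT | c S hS IS | S T hS IS hT IT] x hx.
- exact: hV.
- rewrite !derivation_Vinv // hV //; apply: calB_l2 => //; exact: calB_Vinv.
- exact: hM.
- by rewrite !derivation_add // IS // IT.
- by rewrite !derivation_scale // IS.
by rewrite (derivation_comp hD hS hT hx) (derivation_comp hD' hS hT hx)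
  (IS _ (calB_l2 hT hx)) (IT _ hx).
Qed.

Lemma derivation_sub D D' : is_derivation x1 D -> is_derivation x1 D' ->
  is_derivation x1 (fun b => opsub (D b) (D' b)).
Proof.
move=> hD hD'; split.
- by move=> b hb; apply: Bset_sub; exact: derivation_Bset.
- move=> a b c ha hb x hx; apply/funext => l.
  by rewrite /opsub /opadd /opscale !derivation_lin //; ring.
move=> a b ha hb x hx; apply/funext => l.
rewrite /opadd /opcomp /opsub (derivation_comp hD ha hb hx) (derivation_comp hD' ha hb hx).
have [P _ ->] := calB_ev ha; rewrite ev_B; ring.
Qed.

(** L is unbounded, yet L V^k = V^k (L + k): commutation with it only multiplies a monomial of
    exponent k by k, and so stays in B. *)
Lemma comm_Lop_ev P : comm (@Lop R) (ev x1 P) =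
  ev x1 [seq (p.1, fun x => p.1%:~R * p.2 x) | p <- P].
Proof.
apply/funext => x; apply/funext => l; rewrite /comm /opsub /opcomp /ev big_map.
rewrite /Lop mulr_sumr -sumrB; apply: eq_bigr => p _.
rewrite /mono /wshift /= intrB; ring.
Qed.

Lemma derivation_Lop c : is_derivation x1 (fun b => opscale c (comm (@Lop R) b)).
Proof.
split.
- move=> b /calB_ev [P hP ->]; apply: Bset_scale; rewrite comm_Lop_ev.
  apply: Bset_ev => //; apply: Fpoly_cpoly => _ /mapP [p pP ->] /=.
  by apply: in_F_Z; exact: hP.
- move=> a b d ha hb x hx; apply/funext => l.
  rewrite /opscale /comm /opsub /opadd /opcomp /Lop; ring.
move=> a b ha hb x hx; apply/funext => l.
have [P _ ->] := calB_ev ha.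
rewrite /opscale /comm /opsub /opadd /opcomp ev_Z ev_B; ring.
Qed.

Section PartialDerivation.
Variable d : (G -> R[i]) -> (G -> R[i]).
Hypothesis hd : phi_inv_derivation x1 d.

Lemma d_lin f g c : in_F f -> in_F g ->
  d (fun x => c * f x + g x) = (fun x => c * d f x + d g x).
Proof. by case: hd => _ h _ _; exact: h. Qed.

Lemma d_mul f g : in_F f -> in_F g ->
  d (fun x => f x * g x) = (fun x => d f x * g x + f x * d g x).
Proof. by case: hd => _ _ h _; exact: h. Qed.

Lemma d_0 : d (fun=> 0) = (fun=> 0).
Proof.
have := d_lin 1 in_F_0 in_F_0; under eq_fun do rewrite mulr0 addr0.
move=> h; apply/funext => l; have := congr1 (@^~ l) h.
by rewrite mul1r => /esym/(canRL (addrK _)); rewrite subrr.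
Qed.

Lemma d_Z c f : in_F f -> d (fun x => c * f x) = (fun x => c * d f x).
Proof.
move=> hf; have := d_lin c hf in_F_0; under eq_fun do rewrite addr0.
by move=> ->; apply/funext => x; rewrite d_0 addr0.
Qed.

Lemma d_1 : d (fun=> 1) = (fun=> 0).
Proof.
have := d_mul in_F_cst1 in_F_cst1; under eq_fun do rewrite mulr1.
move=> h; apply/funext => l; have := congr1 (@^~ l) h.
by rewrite mulr1 mul1r => /esym/(canRL (addrK _)); rewrite subrr.
Qed.

Lemma d_trans f (n : int) : in_F f ->
  d (fun x => f (x + x1 *~ n)) = (fun x => d f (x + x1 *~ n)).
Proof.
have hn (m : nat) g : in_F g -> d (fun x => g (x + x1 *+ m)) = (fun x => d g (x + x1 *+ m)).
  move=> hg; elim: m => [|m IH].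
    by under eq_fun do rewrite mulr0n addr0; apply/funext => x; rewrite mulr0n addr0.
  have [_ _ _ h] := hd; have := h _ (in_F_trans (x1 *+ m) hg).
  by rewrite IH; under eq_fun do rewrite -addrA -mulrS; move=> ->;
     apply/funext => x; rewrite -addrA -mulrS.
case: n => m hf; first exact: hn.
have := hn m.+1 _ (in_F_trans (x1 *~ Negz m) hf).
rewrite NegzE mulrNz; under eq_fun do rewrite addrK.
by move=> ->; apply/funext => x; rewrite subrK.
Qed.

Definition dpoly P := [seq (p.1, d p.2) | p <- P].

Lemma in_F_dcoef P n : Fpoly P -> in_F (dcoef P n).
Proof.
move=> hP; have : in_F (fun x => \sum_(p <- [seq p <- P | p.1 == n]) p.2 x).
  by apply: in_F_sum => p; rewrite mem_filter => /andP [_ /hP].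
by congr in_F; apply/funext => x; rewrite big_filter.
Qed.

Lemma dcoef_dpoly P n : Fpoly P -> dcoef (dpoly P) n = d (dcoef P n).
Proof.
elim: P => [_|p P IH h].
  have e0 : dcoef [::] n = (fun=> 0) :> (G -> R[i]).
    by apply/funext => x; rewrite /dcoef big_nil.
  by rewrite /= e0 d_0.
have hP : Fpoly P by move=> q qP; apply: h; rewrite inE qP orbT.
have hp : in_F p.2 by apply: h; rewrite mem_head.
have -> : dcoef (p :: P) n = (fun x => (p.1 == n)%:R * p.2 x + dcoef P n x).
  by apply/funext => x; rewrite /dcoef big_cons; case: ifP; rewrite ?mul1r ?mul0r ?add0r.
rewrite d_lin //; last exact: in_F_dcoef.
rewrite -IH //; apply/funext => x; rewrite /dcoef /= big_cons /=.
by case: ifP; rewrite ?mul1r ?mul0r ?add0r.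
Qed.

Lemma ev_ext P Q : (forall n, dcoef P n = dcoef Q n) -> ev x1 P = ev x1 Q.
Proof.
move=> h; apply/funext => x; apply/funext => l.
pose r := undup (map fst (P ++ Q)).
have evE A : {subset map fst A <= r} ->
    ev x1 A x l = \sum_(k <- r) dcoef A k (x1 *~ (l - k)) * x (l - k).
  move=> hA; rewrite /dcoef; under eq_bigr do rewrite mulr_suml big_mkcond /=.
  rewrite exchange_big /= /ev big_seq [RHS]big_seq; apply: eq_bigr => p pA.
  have pr : p.1 \in r by apply: hA; exact: map_f.
  rewrite (bigD1_seq p.1) ?undup_uniq //= eqxx big1 ?addr0 // => k /negPf.
  by rewrite eq_sym => ->.
rewrite !evE; first by apply: eq_bigr => k _; rewrite h.
  by move=> k hk; rewrite mem_undup map_cat mem_cat hk orbT.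
by move=> k hk; rewrite mem_undup map_cat mem_cat hk.
Qed.

(** A list is not determined by its operator, but its diagonal functions are, by density, and [d]
    acts diagonal by diagonal. *)
Lemma ev_dpoly_wd P Q : Fpoly P -> Fpoly Q -> ev x1 P = ev x1 Q ->
  ev x1 (dpoly P) = ev x1 (dpoly Q).
Proof.
move=> hP hQ e; apply: ev_ext => n; rewrite !dcoef_dpoly //; congr d.
apply: (eq_orbit hdense); try by apply: ccontinuous_dcoef; exact: Fpoly_cpoly.
by move=> l; rewrite -!ev_entry e.
Qed.

(** V^k M_f goes to V^k M_(d f), through a chosen list representing [b]; [opzero] is a default for
    operators without such a list. *)
Definition delta_d b : op R :=
  match pselect (exists P, Fpoly P /\ b = ev x1 P) with
  | left h => ev x1 (dpoly (projT1 (cid h)))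
  | right _ => @opzero R
  end.

Lemma delta_dE P : Fpoly P -> delta_d (ev x1 P) = ev x1 (dpoly P).
Proof.
move=> hP; rewrite /delta_d; case: pselect => [h|[]]; last by exists P.
by case: cid => Q /= [hQ eQ]; apply: ev_dpoly_wd.
Qed.

Lemma cpoly_dpoly P : Fpoly P -> cpoly (dpoly P).
Proof. by move=> hP _ /mapP [p pP ->] /=; case: hd => h _ _ _; exact/h/hP. Qed.

Lemma derivation_delta_d : is_derivation x1 delta_d.
Proof.
split.
- move=> b /calB_ev [P hP ->]; rewrite delta_dE //.
  by apply: Bset_ev => //; exact: cpoly_dpoly.
- move=> a b c /calB_ev [P hP ->] /calB_ev [Q hQ ->] x hx.
  rewrite -ev_scale -ev_cat !delta_dE //; last first.
    by apply: Fpoly_cat => //; exact: Fpoly_scale.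
  rewrite /dpoly map_cat ev_cat -ev_scale -!map_comp; congr (opadd (ev x1 _) _ x).
  by apply/eq_in_map => p pP /=; rewrite d_Z //; exact: hP.
move=> a b /calB_ev [P hP ->] /calB_ev [Q hQ ->] x hx; apply/funext => l.
rewrite ev_comp !delta_dE //; last exact: Fpoly_mul.
rewrite /opadd !ev_comp /ev.
transitivity (\sum_(p <- P) \sum_(q <- Q) (mono x1 (mulmono x1 (p.1, d p.2) q) x l +
    mono x1 (mulmono x1 p (q.1, d q.2)) x l)).
  rewrite /dpoly big_map big_allpairs_dep /= big_seq [RHS]big_seq.
  apply: eq_bigr => p pP; rewrite big_seq [RHS]big_seq; apply: eq_bigr => q qQ.
  have hp := hP _ pP; have hq := hQ _ qQ.
  (* The product V^k M_f V^m M_g involves the translate f(. + x_m); invariance under phi lets [d]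
     pass through it. *)
  by rewrite /mono /wshift /= d_mul ?d_trans //; [ring|exact: in_F_trans].
under eq_bigr do rewrite big_split /=.
rewrite big_split /= !big_allpairs_dep /dpoly big_map; congr (_ + _).
by apply: eq_bigr => p _; rewrite big_map.
Qed.

Lemma delta_d_partial : is_delta_partial x1 d delta_d.
Proof.
split; first exact: derivation_delta_d.
  rewrite (VopE R x1) -ev_seq1 delta_dE; last exact: Fpoly1 in_F_cst1.
  move=> x _; apply/funext => l.
  by rewrite /dpoly /= d_1 ev_seq1 /mono /wshift mul0r.
by move=> f hf x _; rewrite !MopE -ev_seq1 delta_dE ?ev_seq1 //; exact: Fpoly1.
Qed.

End PartialDerivation.
End Generators.

(** * Diagonals of a derivation and approximate innerness *)

Section Decomposition.
Variables (R : realType) (G : topologicalZmodType).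
Hypothesis hcompact : compact [set: G].
Variable x1 : G.
Hypothesis hdense : closure (range (fun n : int => x1 *~ n)) = [set: G].
Implicit Types (f g chi psi : G -> R[i]) (S T : op R).
Local Notation E l := (ebasis R l).

(** Serves to rearrange Leibniz identities between matrix entries: [ring] checks that the two
    differences agree. *)
Lemma eq_of_sub (V : zmodType) (a b c d : V) : a = b -> c - d = a - b -> c = d.
Proof. by move=> ->; rewrite subrr => /eqP; rewrite subr_eq0 => /eqP. Qed.

Lemma orbitS (l : int) : x1 *~ l + x1 = x1 *~ (l + 1).
Proof. by rewrite mulrzDr mulr1z. Qed.

Lemma MopA f x m : Mop x1 f x m = f (x1 *~ m) * x m. Proof. by []. Qed.

Lemma VopA (x : int -> R[i]) m : Vop x m = x (m - 1). Proof. by []. Qed.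

Lemma VinvA (x : int -> R[i]) m : Vinv x m = x (m + 1). Proof. by []. Qed.

Lemma Vop_basis l : Vop (E l) = E (l + 1).
Proof.
apply/funext => m; rewrite /Vop /ebasis.
by have -> : (m - 1 == l) = (m == l + 1) by apply/eqP/eqP; lia.
Qed.

Lemma Mop_basis f l : Mop x1 f (E l) = (fun m => f (x1 *~ l) * E l m).
Proof.
apply/funext => m; rewrite /Mop /ebasis; case: eqP => [->|_] //.
by rewrite !mulr0.
Qed.

Lemma entry_M T f l : bounded_op T ->
  T (Mop x1 f (E l)) = (fun m => f (x1 *~ l) * T (E l) m).
Proof. by move=> bT; rewrite Mop_basis bounded_Z //; exact: l2_basis. Qed.

Lemma chi_orbitD chi (m n : int) : is_character chi ->
  chi (x1 *~ (m + n)) = chi (x1 *~ m) * chi (x1 *~ n).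
Proof. by move=> [_ cM _]; rewrite mulrzDr cM. Qed.

Section Diagonals.
Variable D : op R -> op R.
Hypothesis hD : is_derivation x1 D.

Lemma derivation_comm_M f g : in_F f -> in_F g -> forall l m,
  D (Mop x1 f) (E l) m * (g (x1 *~ l) - g (x1 *~ m)) =
  D (Mop x1 g) (E l) m * (f (x1 *~ l) - f (x1 *~ m)).
Proof.
move=> hf hg l m.
have bf : calB x1 (Mop x1 f) by exact: calB_M_F.
have bg : calB x1 (Mop x1 g) by exact: calB_M_F.
have bDf : bounded_op (D (Mop x1 f)) by exact: derivation_bounded bf.
have bDg : bounded_op (D (Mop x1 g)) by exact: derivation_bounded bg.
have e : opcomp (Mop x1 f) (Mop x1 g) = opcomp (Mop x1 g) (Mop x1 f).
  by apply/funext => x; apply/funext => k; rewrite /opcomp /Mop mulrCA.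
have h1 := derivation_comp hD bf bg (l2_basis R l).
have h2 := derivation_comp hD bg bf (l2_basis R l).
rewrite e h2 in h1; have /= := congr1 (@^~ m) h1; rewrite !entry_M //.
rewrite !MopA => /esym/eq_of_sub; apply; ring.
Qed.

Lemma derivation_comm_V f : in_F f -> forall l m,
  D (Mop x1 f) (E (l + 1)) m + f (x1 *~ m) * D (@Vop R) (E l) m =
  f (x1 *~ (l + 1)) * D (@Vop R) (E l) m
  + D (Mop x1 (fun x => f (x + x1))) (E l) (m - 1).
Proof.
move=> hf l m.
have bf : calB x1 (Mop x1 f) by exact: calB_M_F.
have bg : calB x1 (Mop x1 (fun x => f (x + x1))) by apply: calB_M_F; exact: in_F_trans.
have bV := calB_V R x1.
have bDV : bounded_op (D (@Vop R)) by exact: derivation_bounded bV.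
have e : opcomp (Mop x1 f) (@Vop R) = opcomp (@Vop R) (Mop x1 (fun x => f (x + x1))).
  apply/funext => x; apply/funext => k; rewrite /opcomp /Mop /Vop.
  by rewrite orbitS subrK.
have h1 := derivation_comp hD bf bV (l2_basis R l).
have h2 := derivation_comp hD bV bg (l2_basis R l).
rewrite e h2 in h1; have /= := congr1 (@^~ m) h1; rewrite entry_M // Vop_basis.
by rewrite VopA MopA orbitS => <-.
Qed.

(* For [n <> 0] a character [psi] with [psi (x_n) <> 1] gives the coefficient
   of [V^n] in the implementing element by division. *)
Lemma offdiag_inner n psi : is_character psi -> psi (x1 *~ n) != 1 ->
  exists b : G -> R[i], [/\ ccontinuous b,
    (forall chi, is_character chi -> forall l,
      D (Mop x1 chi) (E l) (l + n) =
      b (x1 *~ l) * (chi (x1 *~ l) - chi (x1 *~ (l + n)))) &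
    forall l, D (@Vop R) (E l) (l + n + 1) = b (x1 *~ (l + 1)) - b (x1 *~ l)].
Proof.
move=> hpsi psi1.
have [_ psi0 _] := char_orbit hpsi.
have w0 : 1 - psi (x1 *~ n) != 0 by rewrite subr_eq0 eq_sym.
have [a [ca ha]] := Bset_coef hcompact hdense n (derivation_Bset hD (calB_M x1 hpsi)).
have cpsi : ccontinuous psi by case: hpsi.
have diff l : psi (x1 *~ l) - psi (x1 *~ (l + n)) =
    psi (x1 *~ l) * (1 - psi (x1 *~ n)) by rewrite chi_orbitD // mulrBr mulr1.
have psiV : forall x, (psi x)^-1 = (psi x)^*%C.
  move=> x; apply: (mulfI (psi0 x)); rewrite mulfV // mulcJ.
  case: hpsi => _ _ /(_ x); rewrite normE => /(congr1 (fun z => z ^+ 2)).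
  by rewrite expr1n -rmorphXn.
(* The factor 1/psi is written as a conjugate so that continuity is immediate. *)
pose b x := (1 - psi (x1 *~ n))^-1 * (a x * (psi x)^*%C).
have cb : ccontinuous b.
  by apply: ccontinuousZ; apply: ccontinuousM => //; exact: ccontinuousJ.
have hb l : a (x1 *~ l) = b (x1 *~ l) * (psi (x1 *~ l) - psi (x1 *~ (l + n))).
  rewrite diff /b -psiV; have := psi0 (x1 *~ l) => p0; field.
  by rewrite w0 p0.
have hM chi : is_character chi -> forall l, D (Mop x1 chi) (E l) (l + n) =
      b (x1 *~ l) * (chi (x1 *~ l) - chi (x1 *~ (l + n))).
  move=> hchi l.
  have := derivation_comm_M (in_F_char hchi) (in_F_char hpsi) l (l + n).
  rewrite -ha hb => h.
  have nz : psi (x1 *~ l) - psi (x1 *~ (l + n)) != 0 by rewrite diff mulf_neq0.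
  by apply: (mulIf nz); rewrite h mulrAC.
exists b; split => // l.
(* As psi(x + x_1) = psi(x_1) psi(x), the last term again involves D(M_psi); the relation then gives
   the entry of D(V) in terms of [b], after division by a nonzero difference of values of psi. *)
have := derivation_comm_V (in_F_char hpsi) l (l + n + 1).
have -> : D (Mop x1 (fun x => psi (x + x1))) (E l) (l + n + 1 - 1) =
   psi x1 * D (Mop x1 psi) (E l) (l + n).
  have -> : Mop x1 (fun x => psi (x + x1)) = opscale (psi x1) (Mop x1 psi).
    apply/funext => x; apply/funext => k; rewrite /opscale /Mop.
    by case: hpsi => _ cM _; rewrite cM mulrA [psi x1 * _]mulrC.
  by rewrite (derivation_scale hD) ?addrK //; [exact: calB_M | exact: l2_basis].
have -> : l + n + 1 = l + 1 + n by rewrite addrAC.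
rewrite !hM // => h.
have nz : psi (x1 *~ (l + 1)) - psi (x1 *~ (l + 1 + n)) != 0.
  by rewrite diff mulf_neq0.
apply: (mulfI nz).
have e1 : psi (x1 *~ (l + 1)) = psi x1 * psi (x1 *~ l) by rewrite chi_orbitD // mulrC.
have e2 : psi (x1 *~ (l + 1 + n)) = psi x1 * psi (x1 *~ (l + n)).
  by rewrite addrAC (chi_orbitD (l + n) 1 hpsi) mulrC.
by move: h; rewrite e1 e2 => /esym/eq_of_sub; apply; ring.
Qed.

Lemma exists_partial : exists d, phi_inv_derivation x1 d /\
  forall f, in_F f -> forall l, d f (x1 *~ l) = D (Mop x1 f) (E l) l.
Proof.
have /choice [d hd] : forall f, exists g, in_F f -> ccontinuous g /\
    forall l : int, g (x1 *~ l) = D (Mop x1 f) (E l) l.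
  (* Outside F the value of [d] is arbitrary; [f] itself is the default. *)
  move=> f; have [hf|hf] := pselect (in_F f); last by exists f.
  have [g [cg hg]] := Bset_coef hcompact hdense 0 (derivation_Bset hD (calB_M_F x1 hf)).
  by exists g => _; split => // l; rewrite hg addr0.
exists d; split; last by move=> f /hd [].
have hc f : in_F f -> ccontinuous (d f) by move=> /hd [].
have ho f : in_F f -> forall l : int, d f (x1 *~ l) = D (Mop x1 f) (E l) l by move=> /hd [].
split => //.
- move=> f g c hf hg; have hfg := in_F_lin c hf hg.
  apply: (eq_orbit hdense); first exact: hc.
    by apply: ccontinuousD; [apply: ccontinuousZ|]; exact: hc.
  move=> l; rewrite !ho //.
  have -> : Mop x1 (fun x => c * f x + g x) = opadd (opscale c (Mop x1 f)) (Mop x1 g).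
    by apply/funext => x; apply/funext => k; rewrite /opadd /opscale /Mop mulrDl mulrA.
  by rewrite (derivation_lin hD) //; [exact: calB_M_F | exact: calB_M_F | exact: l2_basis].
- move=> f g hf hg; have hfg := in_F_mul hf hg.
  apply: (eq_orbit hdense); first exact: hc.
    by apply: ccontinuousD; apply: ccontinuousM; (exact: hc || exact: in_F_cont).
  move=> l; rewrite !ho //.
  have -> : Mop x1 (fun x => f x * g x) = opcomp (Mop x1 f) (Mop x1 g).
    by apply/funext => x; apply/funext => k; rewrite /opcomp /Mop mulrA.
  rewrite (derivation_comp hD) //; [|exact: calB_M_F|exact: calB_M_F|exact: l2_basis].
  rewrite entry_M; last by apply: (derivation_bounded hD); exact: calB_M_F.
  by rewrite MopA mulrC.
move=> f hf; have hf1 := in_F_trans x1 hf.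
apply: (eq_orbit hdense); first exact: hc.
  by apply: ccontinuous_trans; exact: hc.
move=> l; rewrite ho // orbitS ho //.
(* On this diagonal the two terms containing D(V) coincide and cancel, which leaves invariance under
   phi. *)
have := derivation_comm_V hf l (l + 1); rewrite addrK.
by rewrite [X in _ = X]addrC => /addIr.
Qed.

Hypothesis hhaus : hausdorff_space G.
Hypothesis hinf : ~ finite_set [set: G].

(* [y N] is the Fejer sum of the implementing elements of the off-diagonal
   parts, plus a function whose coboundary almost is the diagonal part. *)
Lemma approx_inner_of_diag :
  (forall chi, is_character chi -> forall l, D (Mop x1 chi) (E l) l = 0) ->
  (forall e : R, 0 < e -> exists2 u : G -> R[i], ccontinuous u &
    forall l : int, cabs (D (@Vop R) (E l) (l + 1) - (u (x1 *~ (l + 1)) - u (x1 *~ l))) <= e) ->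
  approx_inner x1 D.
Proof.
move=> hM0 hV0.
have /choice [b hb] : forall n : int, exists b : G -> R[i],
   [/\ ccontinuous b, (forall chi, is_character chi -> forall l,
      D (Mop x1 chi) (E l) (l + n) =
      b (x1 *~ l) * (chi (x1 *~ l) - chi (x1 *~ (l + n)))),
    n = 0 -> b = (fun=> 0) &
    n != 0 -> forall l, D (@Vop R) (E l) (l + n + 1) = b (x1 *~ (l + 1)) - b (x1 *~ l)].
  (* The main diagonal of [y] is reserved for [u], hence b = 0 at n = 0; this agrees with the
     vanishing diagonal of D(M_chi). *)
  move=> n; have [->|n0] := eqVneq n 0.
    exists (fun=> 0); split => //; first exact: ccontinuous_cst.
    by move=> chi hc l; rewrite addr0 hM0 // mul0r.
  have [psi hpsi psi1] := exists_char R hcompact hdense hhaus hinf n0.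
  have [b0 [h1 h2 h3]] := offdiag_inner hpsi psi1.
  by exists b0; split => // e; rewrite e eqxx in n0.
have j0 (j : nat) : 0 < j.+1%:R^-1 :> R by rewrite invr_gt0.
have /choice [u /all_and2 [cu hu]] : forall N : nat, exists u : G -> R[i], ccontinuous u /\
    forall l : int, cabs (D (@Vop R) (E l) (l + 1) - (u (x1 *~ (l + 1)) - u (x1 *~ l))) <= N.+1%:R^-1.
  by move=> N; have [u ? ?] := hV0 _ (j0 N); exists u.
(* A difference n is listed once for each pair (j, i) with j - i = n, so the repetitions produce the
   Fejer weights. *)
pose pairs N := [seq ((nat_of_ord j)%:Z - (nat_of_ord i)%:Z) | j <- enum 'I_N, i <- enum 'I_N].
pose Y N : seq (int * (G -> R[i])) :=
  (0, u N) :: [seq (n, fun x => N%:R^-1 * b n x) | n <- pairs N].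
have cY N : cpoly (Y N).
  apply/cpoly_cons; split => //= _ /mapP [n _ ->] /=.
  by apply: ccontinuousZ; have [] := hb n.
pose y N := ev x1 (Y N).
have yE N x l : y N x l = u N (x1 *~ l) * x l +
    N%:R^-1 * \sum_(j < N) \sum_(i < N) b (j%:Z - i%:Z) (x1 *~ (l - (j%:Z - i%:Z))) * x (l - (j%:Z - i%:Z)).
  rewrite /y /ev /Y big_cons {1}/mono /wshift /= subr0 big_map big_allpairs_dep; congr (_ + _).
  rewrite mulr_sumr big_enum; apply: eq_bigr => j _; rewrite big_enum /= mulr_sumr.
  by apply: eq_bigr => i _; rewrite /mono /wshift /= mulrA.
suff hcv : forall c, calB x1 c -> opcvg (fun N => comm (y N) c) (D c).
  split => //; exists nat, \oo; split; first exact: _.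
  exists y; split; first by move=> N; apply: Bset_ev.
  by move=> c hc e e0; exact: hcv.
have cvV : opcvg (fun N => comm (y N) (@Vop R)) (D (@Vop R)).
  move=> e e0; have e2 : 0 < e / 2 by rewrite divr_gt0.
  (* [V^n M_b, V] lies on diagonal n + 1, but its weight in [y] is the one for n. Removing V from
     D(V) realigns diagonals and weights. *)
  pose T := opcomp (@Vinv R) (D (@Vop R)).
  have BT : Bset x1 T.
    by apply: Bset_comp; [exact: Bset_Vinv|exact: derivation_Bset (calB_V R x1)].
  have hN : \forall N \near \oo, N.+1%:R^-1 <= e / 2 :> R /\ (0 < N)%N.
    exists (Num.truncn (e / 2)^-1).+1 => // N /= hN; split; last exact: leq_ltn_trans hN.
    rewrite -[leRHS]invrK lef_pV2 ?posrE ?invr_gt0 ?ltr0n //; apply: ltW.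
    apply: lt_le_trans (truncnS_gt _) _; rewrite ler_nat; exact: leqW.
  apply: filterS2 hN (fejer_cvg hcompact BT e2) => N [N1 N0] hf.
  (* For N > 0, [fejer] leaves the main diagonal of [T] unchanged; adding [w] replaces it by the
     coboundary of [u N], at a cost of at most e/2. *)
  pose w l := u N (x1 *~ (l + 1)) - u N (x1 *~ l) - D (@Vop R) (E l) (l + 1).
  have hw : opnorm_le (wshift 0 w) (e / 2).
    by apply: opnorm_wshift => l; rewrite /w cabs_distC; exact: le_trans (hu N l) N1.
  have hVn : opnorm_le (@Vop R) 1.
    by rewrite (VopE R x1); apply: opnorm_wshift => l; rewrite cabs1.
  have := opnorm_leD e2 e2 hf hw; rewrite -splitr => h.
  have := opnorm_le_comp hVn h; rewrite mul1r; apply: opeq_opnorm => x hx.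
  apply/funext => l; rewrite /comm /opcomp /opadd /opsub.
  have TE z : T z (l - 1) = D (@Vop R) z l by rewrite /T /opcomp VinvA subrK.
  rewrite VopA [Vop (y N x) l]VopA TE !yE /wshift subr0 /fejer.
  pose A (j i : 'I_N) := b (j%:Z - i%:Z) (x1 *~ (l - (j%:Z - i%:Z))) *
    Vop x (l - (j%:Z - i%:Z)).
  pose B (j i : 'I_N) := b (j%:Z - i%:Z) (x1 *~ (l - 1 - (j%:Z - i%:Z))) *
    x (l - 1 - (j%:Z - i%:Z)).
  pose v := D (@Vop R) (E (l - 1)) l * x (l - 1).
  have term (j i : 'I_N) : T (E (l - 1 - j%:Z + i%:Z)) (l - 1) *
      x (l - 1 - j%:Z + i%:Z) = A j i - B j i + (i == j)%:R * v.
    have em : l - 1 - j%:Z + i%:Z = l - 1 - (j%:Z - i%:Z) by rewrite opprB addrA addrAC.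
    have em' : l - (j%:Z - i%:Z) = l - 1 - (j%:Z - i%:Z) + 1 by rewrite addrAC subrK.
    rewrite TE em; have [-> | ij] := eqVneq i j.
      rewrite /A /B subrr subr0; have [_ _ -> // _] := hb 0.
      by rewrite !mul0r subrr add0r mul1r ?subr0.
    have n0 : j%:Z - i%:Z != 0.
      by rewrite subr_eq0; apply: contra ij => /eqP [] /val_inj ->.
    have [_ _ _ /(_ n0 (l - 1 - (j%:Z - i%:Z)))] := hb (j%:Z - i%:Z).
    rewrite !subrK => ->; rewrite -em' /A /B VopA mul0r addr0.
    have -> : l - (j%:Z - i%:Z) - 1 = l - 1 - (j%:Z - i%:Z) by rewrite addrAC.
    by rewrite mulrBl.
  under eq_bigr do under eq_bigr do rewrite term.
  have -> : \sum_(j < N) \sum_(i < N) (A j i - B j i + (i == j)%:R * v) =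
      \sum_j \sum_i A j i - \sum_j \sum_i B j i + N%:R * v.
    rewrite -sumrB.
    have -> : N%:R * v = \sum_(j < N) v by rewrite sumr_const card_ord mulr_natl.
    rewrite -big_split /=; apply: eq_bigr => j _; rewrite big_split /= sumrB; congr (_ + _).
    rewrite (bigD1 j) //= eqxx mul1r big1 ?addr0 // => i /negPf ->.
    by rewrite mul0r.
  have NV : N%:R^-1 * N%:R = 1 :> R[i] by rewrite mulVf // pnatr_eq0 -lt0n.
  rewrite mulrDr (mulrA _ N%:R) NV mul1r mulrBr.
  rewrite /w subrK -/v -/(A _ _) [Vop x l]VopA.
  have -> : \sum_(j < N) \sum_(i < N) b (j%:Z - i%:Z) (x1 *~ (l - (j%:Z - i%:Z))) *
    Vop x (l - (j%:Z - i%:Z)) = \sum_j \sum_i A j i by [].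
  have -> : \sum_(j < N) \sum_(i < N) b (j%:Z - i%:Z) (x1 *~ (l - 1 - (j%:Z - i%:Z))) *
    x (l - 1 - (j%:Z - i%:Z)) = \sum_j \sum_i B j i by [].
  rewrite /v; ring.
(* Here there is no error term: [u N] commutes with M_chi, and the commutator of [y N] with M_chi is
   the Fejer sum of D(M_chi). *)
have cvM chi : is_character chi -> opcvg (fun N => comm (y N) (Mop x1 chi)) (D (Mop x1 chi)).
  move=> hc e e0.
  apply: filterS (fejer_cvg hcompact (derivation_Bset hD (calB_M x1 hc)) e0) => N.
  apply: opeq_opnorm => x hx; apply/funext => l; congr (_ - _).
  rewrite /comm /opsub /opcomp MopA !yE /fejer MopA.
  rewrite mulrDr mulrCA opprD addrACA subrr add0r.
  rewrite [chi _ * (_ * _)]mulrCA -mulrBr; congr (_ * _).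
  rewrite mulr_sumr -sumrB; apply: eq_bigr => j _.
  rewrite mulr_sumr -sumrB; apply: eq_bigr => i _; rewrite MopA.
  have -> : l - j%:Z + i%:Z = l - (j%:Z - i%:Z) by rewrite opprB addrA addrAC.
  have [_ /(_ chi hc (l - (j%:Z - i%:Z))) + _ _] := hb (j%:Z - i%:Z).
  by rewrite subrK => ->; ring.
have bdd T : calB x1 T -> exists2 k : R, 0 < k & opnorm_le T k.
  by move=> hT; exact/bounded_norm/(calB_bounded hcompact hT).
(* Convergence spreads from the generators to calB because commutators and [D] both obey the Leibniz
   rule; for V^-1 it comes from [y, V^-1] = -V^-1 [y, V] V^-1. *)
move=> c; elim=> [|| chi hc | S T hS IS hT IT | k S hS IS | S T hS IS hT IT] // e e0.
- have hn : opnorm_le (@Vinv R) 1.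
    by rewrite (VinvE R x1); apply: opnorm_wshift => l; rewrite cabs1.
  apply: filterS (cvV e e0) => N h.
  have := opnorm_leZ (-1) (opnorm_le_comp hn (opnorm_le_comp h hn)).
  rewrite cabsN cabs1 !mul1r mulr1; apply: opeq_opnorm => x hx; apply/funext => l.
  rewrite /opscale /opsub /comm /opsub /opcomp (derivation_Vinv hcompact hD) //.
  by rewrite !VinvA VinvK VopA addrK; ring.
- exact: cvM.
- have e2 : 0 < e / 2 by rewrite divr_gt0.
  apply: filterS2 (IS _ e2) (IT _ e2) => N h1 h2; rewrite (splitr e).
  have := opnorm_leD e2 e2 h1 h2; apply: opeq_opnorm => x hx; apply/funext => l.
  by rewrite /opadd /opsub /comm /opsub /opcomp /y (derivation_add hD) // ev_D; ring.
- have c1 : 0 < cabs k + 1 by rewrite ltr_wpDl ?cabs_ge0.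
  have e2 : 0 < e / (cabs k + 1) by rewrite divr_gt0.
  apply: filterS (IS _ e2) => N h.
  apply: (@opnorm_leW _ _ (cabs k * (e / (cabs k + 1)))).
  + by rewrite mulr_ge0 ?cabs_ge0 // ltW.
  + by rewrite mulrA ler_pdivrMr // mulrC ler_wpM2l ?(ltW e0) // lerDl.
  apply: opeq_opnorm (opnorm_leZ k h) => x hx; apply/funext => l.
  by rewrite /opscale /opsub /comm /opsub /opcomp /y (derivation_scale hD) // ev_Z; ring.
have [s s0 hs] := bdd _ hS; have [t t0 ht] := bdd _ hT.
have es : 0 < e / 2 / s by rewrite !divr_gt0.
have et : 0 < e / 2 / t by rewrite !divr_gt0.
apply: filterS2 (IS _ et) (IT _ es) => N h1 h2.
have e2 : 0 < e / 2 by rewrite divr_gt0.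
have k1 := opnorm_le_comp h1 ht; rewrite divfK ?gt_eqF // in k1.
have k2 := opnorm_le_comp hs h2; rewrite mulrC divfK ?gt_eqF // in k2.
rewrite (splitr e); have := opnorm_leD e2 e2 k1 k2; apply: opeq_opnorm => x hx.
apply/funext => l; rewrite /opadd /opsub (derivation_comp hD hS hT hx) /comm /opsub /opcomp.
by have [P _ ->] := calB_ev hS; rewrite !ev_B; ring.
Qed.
End Diagonals.

Lemma approx_inner_diag Dt f : approx_inner x1 Dt -> in_F f ->
  forall l, Dt (Mop x1 f) (E l) l = 0.
Proof.
move=> [hD [J [F [FF [y [By hy]]]]]] hf l.
apply/eqP; rewrite -cabs_eq0 eq_le cabs_ge0 andbT; apply/ler_addgt0Pr => e e0.
have [j hj] := filter_ex (hy _ (calB_M_F x1 hf) e e0).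
have := opnorm_entry l l (ltW e0) hj; rewrite /opsub /comm /opsub /opcomp.
rewrite entry_M; last exact: Bset_bounded (By j).
by rewrite MopA subrr sub0r cabsN add0r.
Qed.

(** The main diagonal of a single sufficiently good [y j] serves as [u]: the entry of [y, V] from
    E_l to E_(l+1) is the difference of two consecutive diagonal entries of y. *)
Lemma approx_inner_coboundary Dt : approx_inner x1 Dt -> forall e : R, 0 < e ->
  exists2 u : G -> R[i], ccontinuous u & forall l : int,
    cabs (Dt (@Vop R) (E l) (l + 1) - (u (x1 *~ (l + 1)) - u (x1 *~ l))) <= e.
Proof.
move=> [hD [J [F [FF [y [By hy]]]]]] e e0.
have [j hj] := filter_ex (hy _ (calB_V R x1) e e0).
have [u [cu hu]] := Bset_coef hcompact hdense 0 (By j).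
exists u => // l; have := opnorm_entry l (l + 1) (ltW e0) hj.
by rewrite /opsub /comm /opsub /opcomp Vop_basis VopA addrK !hu !addr0 cabs_distC.
Qed.

Lemma delta_partial_unique d D D' :
  is_delta_partial x1 d D -> is_delta_partial x1 d D' ->
  forall b : op R, calB x1 b -> opeq (D b) (D' b).
Proof.
move=> [h1 V1 M1] [h2 V2 M2]; apply: derivation_ext => //.
  by move=> x hx; rewrite V1 // V2.
by move=> chi hc x hx; rewrite M1 ?M2 //; exact: in_F_char.
Qed.

Lemma comm_Lop_V x l : comm (@Lop R) (@Vop R) x l = x (l - 1).
Proof. by rewrite /comm /opsub /opcomp VopA /Lop VopA -mulrBl -intrB subKr mul1r. Qed.

Lemma comm_Lop_M f x l : comm (@Lop R) (Mop x1 f) x l = 0.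
Proof. by rewrite /comm /opsub /opcomp MopA /Lop MopA mulrCA subrr. Qed.

End Decomposition.

(** * Existence and uniqueness of the decomposition *)

Theorem theorem3p15 (R : realType) (G : topologicalZmodType)
  (hcompact : compact [set: G]) (hhaus : hausdorff_space G)
  (hinf : ~ finite_set [set: G]) (x1 : G)
  (hdense : closure (range (fun n : int => x1 *~ n)) = [set: G])
  (delta : op R -> op R) (hdelta : is_derivation x1 delta) :
  exists (c0 : R[i]) (d : (G -> R[i]) -> (G -> R[i])) (Dt : op R -> op R),
    [/\ phi_inv_derivation x1 d,
        approx_inner x1 Dt,
        (exists D : op R -> op R,
           [/\ is_delta_partial x1 d D,
               (forall D' : op R -> op R, is_delta_partial x1 d D' ->
                  forall b, calB x1 b -> opeq (D' b) (D b))
             & decomposes x1 delta c0 D Dt])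
      & (forall (c0' : R[i]) (d' : (G -> R[i]) -> (G -> R[i]))
                (Dt' D' : op R -> op R),
           phi_inv_derivation x1 d' -> approx_inner x1 Dt' ->
           is_delta_partial x1 d' D' -> decomposes x1 delta c0' D' Dt' ->
           [/\ c0' = c0, (forall f, in_F f -> d' f = d f)
             & (forall b, calB x1 b -> opeq (Dt' b) (Dt b))])].
Proof.
have [d [hd hdo]] := exists_partial hcompact hdense hdelta.
have [f0 [cf0 hf0]] := Bset_coef hcompact hdense 1 (derivation_Bset hdelta (calB_V R x1)).
have [c0 hc0] := exists_mean hcompact hdense cf0.
have hD := delta_d_partial hcompact hdense hd.
have [dD DV DM] := hD; set D := delta_d x1 d in hD dD DV DM.
(* The remainder is defined by subtraction. The choice of [d] clears its diagonal on M_chi, and the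
   choice of [c0] as mean of [f0] makes its diagonal on V a limit of coboundaries. *)
pose Dt b := opsub (opsub (delta b) (opscale c0 (comm (@Lop R) b))) (D b).
have dDt : is_derivation x1 Dt.
  apply: derivation_sub => //; apply: derivation_sub => //.
  exact: derivation_Lop.
have hDt : approx_inner x1 Dt.
  apply: (approx_inner_of_diag hcompact hdense dDt hhaus hinf).
    move=> chi hc l; rewrite /Dt /opsub /opscale comm_Lop_M mulr0 subr0.
    rewrite DM; [|exact: in_F_char|exact: l2_basis].
    by rewrite Mop_basis /ebasis eqxx mulr1 hdo ?subrr //; exact: in_F_char.
  move=> e e0; have [u cu hu] := hc0 e e0; exists u => // l.
  rewrite /Dt /opsub /opscale comm_Lop_V addrK DV; last exact: l2_basis.
  rewrite /opzero subr0 /ebasis eqxx mulr1 -hf0 -orbitS; exact: hu.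
exists c0, d, Dt; split => //.
  exists D; split => //; first by move=> D' hD'; exact: delta_partial_unique hD' hD.
  by move=> b hb x hx; apply/funext => l; rewrite /opadd /opscale /Dt /opsub /opscale; ring.
move=> c0' d' Dt' D' hd' hDt' hD' dec.
have [dD' DV' DM'] := hD'.
(* In the entry of delta(V) from E_l to E_(l+1), the term with L contributes the constant, [D']
   nothing, and [Dt'] a limit of coboundaries; so both constants are means of [f0]. *)
have ec : c0' = c0.
  apply: (@has_mean_unique R G hcompact x1 (fun l => f0 (x1 *~ l))).
    move=> e e0; have [u cu hu] := approx_inner_coboundary hcompact hdense hDt' e0.
    exists u => // l; apply: le_trans (hu l).
    rewrite hf0 (dec _ (calB_V R x1) _ (l2_basis R l)) /opadd /opscale.
    rewrite comm_Lop_V addrK /ebasis eqxx mulr1 DV'; last exact: l2_basis.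
    by rewrite /opzero add0r [c0' + _]addrC addrK.
  move=> e e0; have [u cu hu] := hc0 e e0; exists u => // l.
  by rewrite -orbitS; exact: hu.
have ed f : in_F f -> d' f = d f.
  move=> hf; apply: (eq_orbit hdense).
  - by case: hd' => h _ _ _; exact: h.
  - by case: hd => h _ _ _; exact: h.
  move=> l; rewrite hdo // (dec _ (calB_M_F x1 hf) _ (l2_basis R l)) /opadd /opscale.
  rewrite comm_Lop_M mulr0 add0r (approx_inner_diag hDt' hf) addr0 DM' //; last exact: l2_basis.
  by rewrite Mop_basis /ebasis eqxx mulr1.
split => // b hb x hx.
(* As d' = d on F, [D'] and [D] satisfy the same defining conditions and agree on calB, so the
   remainders agree by subtraction. *)
have hD'' : is_delta_partial x1 d D'.
  by split => // f hf y hy; rewrite -ed //; exact: DM'.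
apply/funext => l; rewrite /Dt /opsub (dec b hb x hx) /opadd (delta_partial_unique hcompact hD'' hD hb hx) ec.
by ring.
Qed.
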